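(* Let $1\leq k<d$ and $n\geq1$ be integers, let $V$ be a $k$-dimensional subspace of $\mathbb{R}^d$, and let $X\subseteq\mathbb{R}^d$ and $Y\subseteq\mathbb{R}^n$ be non-empty Borel sets. Let $\alpha\in(0,1)$ and let $B^\alpha:\mathbb{R}^n\to V$ be index $\alpha$ fractional Brownian motion with $V$ identified with $\mathbb{R}^k$. If $\dim_{\mathrm H}X<k$, then almost surely \[ \dim_{\mathrm H}(X+B^\alpha(Y))\geq\min\left\{\dim_{\mathrm H}X+\frac{\dim_{\mathrm H}Y}{\alpha}-\frac{\dim_{\mathrm H}X\,\dim_{\mathrm H}Y}{k\alpha},\ k\right\}. \]
   Context: $\dim_{\mathrm H}$ is Hausdorff dimension and $A+B=\{a+b:a\in A,\ b\in B\}$ is the sumset. Index $\alpha$ fractional Brownian motion $B^\alpha:\mathbb{R}^n\to\mathbb{R}^k$ is the centred Gaussian process with continuous sample paths whose $k$ coordinate processes are independent and identically distributed, each real-valued coordinate $W$ satisfying $W(0)=0$ and $\mathbb{E}\left(|W(x)-W(y)|^2\right)=|x-y|^{2\alpha}$ for all $x,y\in\mathbb{R}^n$ (Kahane's $(n,k,\gamma)$ Gaussian process with $\gamma=2\alpha$). $V$ is identified with $\mathbb{R}^k$ by a linear isometry. *)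

(* Defs.v *)
From HB Require Import structures.
From mathcomp Require Import all_boot all_order all_algebra.
From mathcomp Require Import all_classical all_reals all_analysis.

Set Implicit Arguments.
Unset Strict Implicit.
Unset Printing Implicit Defensive.

Import Order.TTheory GRing.Theory Num.Theory.
Import numFieldNormedType.Exports.

Local Open Scope classical_set_scope.
Local Open Scope ring_scope.

Section Euclidean.
Context {R : realType}.

(* The library norm on 'rV[R]_m is the sup norm; the Euclidean norm has to be
   introduced separately.  The two induce the same topology. *)
Definition enorm {m : nat} (x : 'rV[R]_m) : R :=
  Num.sqrt (\sum_(i < m) x 0 i ^+ 2).

Definition borel {m : nat} (A : set 'rV[R]_m) : Prop :=
  <<s [set U : set 'rV[R]_m | open U] >> A.

Definition sumset {m : nat} (A B : set 'rV[R]_m) : set 'rV[R]_m :=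
  [set a + b | a in A & b in B].

Definition isometry_onto {m d : nat}
    (phi : {linear 'rV[R]_m -> 'rV[R]_d}) (V : {vspace 'rV[R]_d}) : Prop :=
  (forall u, enorm (phi u) = enorm u) /\ range phi = [set v | v \in V].

End Euclidean.

Section Hausdorff.
Context {R : realType} {m : nat}.
Implicit Types A U : set 'rV[R]_m.
Local Open Scope ereal_scope.

Definition diam U : \bar R :=
  ereal_sup [set (enorm (x - y)%R)%:E | x in U & y in U].

(* The empty set contributes 0 for every s, including s = 0; a non-empty set
   of diameter 0 contributes 1 when s = 0, since 0 `^ 0 = 1. *)
Definition hausdorff_gauge (s : R) U : \bar R :=
  if U == set0 then 0 else poweR (diam U) s.

Definition hausdorff_premeasure (s delta : R) A : \bar R :=
  ereal_inf [set \sum_(i <oo) hausdorff_gauge s (U i)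
            | U in [set U : (set 'rV[R]_m)^nat
                   | A `<=` \bigcup_i U i /\
                     forall i, diam (U i) <= delta%:E]].

Definition hausdorff_measure (s : R) A : \bar R :=
  ereal_sup [set hausdorff_premeasure s delta A
            | delta in [set delta : R | (0 < delta)%R]].

Definition hausdorff_dim A : \bar R :=
  ereal_inf [set s%:E
            | s in [set s : R | (0 <= s)%R /\ hausdorff_measure s A = 0]].

End Hausdorff.

Section Processes.
Context {dT : measure_display} {T : measurableType dT} {R : realType}.
Variable P : probability T R.

(* Constants are Gaussian: the library's normal_prob m 0 is not the Dirac mass
   at m, so the degenerate case is separate. *)
Definition gaussian_law (m s : R) : set R -> \bar R :=
  if s == 0 then dirac m else normal_prob m s.

Definition centred_gaussian (Z : T -> R) : Prop :=
  measurable_fun setT Z /\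
  exists s : R, forall A : set R, measurable A ->
    P (Z @^-1` A) = gaussian_law 0 s A.

Definition centred_gaussian_process {I : Type} (Z : I -> T -> R) : Prop :=
  forall (l : nat) (t : 'I_l -> I) (a : 'I_l -> R),
    centred_gaussian (fun w => \sum_(j < l) a j * Z (t j) w).

Definition process_sigma {I : Type} (Z : I -> T -> R) : set (set T) :=
  <<s \bigcup_(t in [set: I])
        [set Z t @^-1` A | A in [set A : set R | measurable A]] >>.

(* Mutual independence of finitely many processes.  The product rule for
   subfamilies is included, since any A i may be setT. *)
Definition independent_processes {k : nat} {I : Type}
    (Z : 'I_k -> I -> T -> R) : Prop :=
  forall A : 'I_k -> set T, (forall i, process_sigma (Z i) (A i)) ->
    P (\bigcap_(i in [set: 'I_k]) A i) = (\prod_(i < k) P (A i))%E.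

(* Equality of all finite-dimensional distributions, tested on rectangles. *)
Definition same_law {I : Type} (Z Z' : I -> T -> R) : Prop :=
  forall (l : nat) (t : 'I_l -> I) (A : 'I_l -> set R),
    (forall j, measurable (A j)) ->
    P (\bigcap_(j in [set: 'I_l]) (Z (t j) @^-1` A j)) =
    P (\bigcap_(j in [set: 'I_l]) (Z' (t j) @^-1` A j)).

Definition coord_process {n k : nat} (W : 'rV[R]_n -> T -> 'rV[R]_k)
    (i : 'I_k) : 'rV[R]_n -> T -> R :=
  fun x w => W x w 0 i.

Definition fractional_brownian_motion {n k : nat} (alpha : R)
    (W : 'rV[R]_n -> T -> 'rV[R]_k) : Prop :=
  [/\ centred_gaussian_process
        (fun p : 'rV[R]_n * 'I_k => coord_process W p.2 p.1),
      forall w, continuous (fun x => W x w),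
      independent_processes (coord_process W),
      forall i i', same_law (coord_process W i) (coord_process W i') &
      forall i,
        (forall w, coord_process W i 0 w = 0) /\
        forall x y,
          ('E_P[fun w => (`|coord_process W i x w - coord_process W i y w|
                            ^+ 2)%R]
           = (enorm (x - y)%R `^ (2 * alpha))%:E)%E].

End Processes.

(* Main.v *)
Require Import Defs.
From HB Require Import structures.
From mathcomp Require Import all_boot all_order all_algebra.
From mathcomp Require Import all_classical all_reals all_analysis.
From mathcomp Require Import finmap measurable_realfun ring lra zify.

(* The stronger bound min {dim X + dim Y / alpha, k} holds, by an energy argument
   carried out with finitely supported measures only.
   - A Borel set of dimension > t contains a compact set K which, at every scale
     eps, carries a finitely supported probability whose t-energy truncated at
     eps is bounded independently of eps: dyadic net contents are continuous
     along increasing sequences (Davies), hence Borel sets are capacitable for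
     them (Choquet), and on finitely many points a greedy choice of weights
     realizes the net content of a compact set as a mass (Frostman).
   - For z in R^d the probability of |z + B(y) - B(y')| <= r is at most
     C (r / max(|z|, |y - y'|^alpha, r))^k. Hence if t < s + v <= k, s < dim X and
     alpha v < dim Y, the images under (x, y) |-> x + B(y) of products of the above
     discrete measures on X and Y have truncated t-energies whose expectation is
     bounded; by Fatou, almost surely they stay bounded along a subsequence of
     scales.
   - A compact set carrying such discrete measures along a subsequence of scales
     has positive t-dimensional Hausdorff measure: only finite covers matter, and
     a finite cover only sees finitely many scales.
   Distances are measured with the sup norm, which is comparable to [enorm]. *)

Set Implicit Arguments.
Unset Strict Implicit.
Unset Printing Implicit Defensive.

Import Order.TTheory GRing.Theory Num.Theory.
Import numFieldNormedType.Exports.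

Local Open Scope classical_set_scope.
Local Open Scope ring_scope.

(** * Net contents *)

Section NetContent.
Context {R : realType} {E : Type} {L : choiceType}.
Variable lab : nat -> E -> L.
Hypothesis lab_refine : forall i j x y, (i <= j)%N ->
  lab j x = lab j y -> lab i x = lab i y.
Variable wt : nat -> R.
Hypothesis wt_ge0 : forall j, 0 <= wt j.
Implicit Types (A B : set E) (D : set (nat * L)) (c : nat * L).

(** A net is given by labels: its cells of generation [j] are the fibres of [lab j], and
    [lab_refine] makes two meeting cells nested. [content] is the associated Hausdorff content, with
    price [wt j] for a cell of generation [j] and no restriction on cell size. *)
Definition cell c : set E := [set x | lab c.1 x = c.2].
Definition covers D A := forall x, A x -> exists2 c, D c & cell c x.
Definition cost D : \bar R := \esum_(c in D) (wt c.1)%:E.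
Definition content A : \bar R := ereal_inf [set cost D | D in [set D | covers D A]].

Lemma cost_ge0 D : (0 <= cost D)%E.
Proof. by apply: esum_ge0 => c _; rewrite lee_fin. Qed.

Lemma cost_le D D' : D `<=` D' -> (cost D <= cost D')%E.
Proof.
move=> DD'; apply: ge_ereal_sup => _ [F [finF FD]] <-.
by apply: ereal_sup_ubound; exists F => //; split => // c /FD /DD'.
Qed.

Lemma costID D' D : cost D = (cost (D `&` D') + cost (D `&` ~` D'))%E.
Proof. by rewrite /cost (esumID D')// => c _; rewrite lee_fin. Qed.

Lemma costU D D' : (cost (D `|` D') <= cost D + cost D')%E.
Proof.
have e : (D `|` D') `&` D = D.
  by apply/seteqP; split => c; [case|split => //; left].
rewrite [leLHS](costID D) e leeD2l//; apply: cost_le => c [[]//].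
Qed.

Lemma content_ge0 A : (0 <= content A)%E.
Proof. by apply: le_ereal_inf_tmp => _ [D _ <-]; exact: cost_ge0. Qed.

Lemma content_le_cost D A : covers D A -> (content A <= cost D)%E.
Proof. by move=> DA; apply: ereal_inf_lbound; exists D. Qed.

Lemma content_le A B : A `<=` B -> (content A <= content B)%E.
Proof.
move=> AB; apply: le_ereal_inf_tmp => _ [D DB <-].
by apply: content_le_cost => x /AB /DB.
Qed.

(** The comparison of generations is strict, so [tops D] consists of the maximal cells of [D];
    distinct maximal cells are disjoint. *)
Definition above c c' := (c.1 < c'.1)%N /\ cell c' `<=` cell c.
Definition tops D := [set c | D c /\ forall c', D c' -> ~ above c' c].

Lemma above_of_mem c c' x : cell c x -> cell c' x -> (c.1 < c'.1)%N -> above c c'.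
Proof.
move=> cx c'x lt; split => // y; rewrite /cell /= in cx c'x * => yc'.
by rewrite -cx; apply: (lab_refine (ltnW lt)); rewrite c'x.
Qed.

(** Passing to a cell above strictly lowers the generation, so every ascent ends in a maximal
    cell. *)
Lemma covers_tops D A : covers D A -> covers (tops D) A.
Proof.
move=> DA x /DA[c Dc cx].
have [n] := ubnP c.1; elim: n c Dc cx => // n IH c Dc cx cn.
have [[c' [Dc' ac]]|H] := pselect (exists c', D c' /\ above c' c).
  apply: (IH c' Dc') => //; first exact: ac.2.
  exact: leq_trans ac.1 _.
by exists c => //; split => // c' Dc' ac; apply: H; exists c'.
Qed.

Lemma cell_inj c c' x : cell c x -> cell c' x -> c.1 = c'.1 -> c = c'.
Proof. by case: c c' => [i z] [i' z']; rewrite /cell /= => <- <- ->. Qed.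

(* The cells of [D1] that survive in [tops (D1 `|` D2)] may be traded in [D1] for
   the cells of [D2] below them, so near-optimality of [D1] bounds their cost. *)
Lemma cost_tops_union A B D1 D2 (e : R) :
  A `<=` B -> covers D1 A -> covers D2 B ->
  (content A < +oo)%E -> (cost D1 <= content A + e%:E)%E ->
  (cost (tops (D1 `|` D2)) <= cost D2 + e%:E)%E.
Proof.
move=> AB D1A D2B cA cD1.
set M := tops (D1 `|` D2); pose M1 := D1 `&` (M `&` ~` D2).
pose S := [set c | D2 c /\ exists2 c', M1 c' & above c' c].
have fA : content A \is a fin_num by rewrite ge0_fin_numE// content_ge0.
have S_M2 : (cost (M `&` D2) + cost S <= cost D2)%E.
  rewrite [leRHS](costID M); apply: leeD; apply: cost_le.
    by move=> c [].
  by move=> c [D2c [c' [D1c' [Mc' _]] ac]]; split => // -[_] /(_ c') []//; left.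
have covA : covers ((D1 `&` ~` (M `&` ~` D2)) `|` S) A.
  move=> x Ax; have [c Dc cx] := D1A x Ax.
  have [M1c|nM1c] := pselect ((M `&` ~` D2) c); last by exists c => //; left.
  have [d D2d dx] := D2B x (AB _ Ax).
  exists d => //; right; split => //; exists c => //.
  apply: (above_of_mem cx dx); rewrite ltnNge; apply/negP.
  rewrite leq_eqVlt => /orP[/eqP ed|lt].
    by apply: M1c.2; rewrite -(cell_inj dx cx ed).
  by apply: (M1c.1.2 d); [right|apply: above_of_mem dx cx lt].
have M1S : (cost M1 <= cost S + e%:E)%E.
  have := cD1; rewrite (costID (M `&` ~` D2)) -/M1 => H.
  have K := le_trans (content_le_cost covA) (costU _ _).
  have : (cost M1 + cost (D1 `&` ~` (M `&` ~` D2)) <=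
      cost (D1 `&` ~` (M `&` ~` D2)) + cost S + e%:E)%E.
    by apply: (le_trans H); rewrite leeD2r.
  have fin : cost (D1 `&` ~` (M `&` ~` D2)) \is a fin_num.
    rewrite ge0_fin_numE ?cost_ge0//.
    apply: (@le_lt_trans _ _ (content A + e%:E)%E).
      by apply: le_trans H; rewrite leeDr// cost_ge0.
    by rewrite lte_add_pinfty// ltry.
  by rewrite addeC -addeA leeD2lE.
have MM : M `<=` M1 `|` (M `&` D2).
  move=> c Mc; have [D2c|nD2c] := pselect (D2 c); first by right.
  by left; split => //; case: Mc => -[].
apply: (le_trans (cost_le MM)); apply: (le_trans (costU _ _)).
apply: (le_trans (leeD2r _ M1S)).
by rewrite addeAC leeD2r// addeC.
Qed.

(** The covers [C i] are optimal up to errors summing to at most [e]. The maximal cells of the first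
    covers up to [C i] exceed [content (A i)] in cost by at most the errors so far, whence one bound
    for all [i]. *)
Lemma content_bigcup (A : (set E)^nat) (th : R) :
  (forall i, A i `<=` A i.+1) -> (forall i, (content (A i) <= th%:E)%E) ->
  (content (\bigcup_i A i) <= th%:E)%E.
Proof.
move=> Ainc cA; apply/lee_addgt0Pr => e e0.
pose ei i := e / (2 ^+ i.+1).
have ei0 i : 0 < ei i by rewrite divr_gt0// exprn_gt0.
have fA i : content (A i) \is a fin_num.
  by rewrite ge0_fin_numE ?content_ge0// (le_lt_trans (cA i))// ltry.
have /choice[C HC] : forall i, exists D, covers D (A i) /\
    (cost D <= content (A i) + (ei i)%:E)%E.
  move=> i; have /ereal_inf_lt[_ [D cD <-] /ltW le] :
    (content (A i) < content (A i) + (ei i)%:E)%E by rewrite lteDl// lte_fin.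
  by exists D.
pose U i := \bigcup_(j in [set j | (j <= i)%N]) C j.
have UA i : covers (U i) (A i).
  by move=> x /(HC i).1[c Cc cx]; exists c => //; exists i => /=.
have US i : U i.+1 = U i `|` C i.+1.
  apply/seteqP; split => [c [j /=]|c [[j /= ji] Cc|Cc]].
  - by rewrite leq_eqVlt => /orP[/eqP->|ji] Cc; [right|left; exists j].
  - by exists j => //=; exact: leqW.
  - by exists i.+1 => /=.
have topsU i : (cost (tops (U i)) <=
    content (A i) + (\sum_(j < i.+1) ei j)%:E)%E.
  elim: i => [|i IH].
    rewrite big_ord1; apply: le_trans (HC 0%N).2; apply: cost_le => c [].
    by move=> [j /=]; rewrite leqn0 => /eqP ->.
  (* Taking maximal cells in stages loses nothing, so [cost_tops_union] applies with [tops (U i)] as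
     the cover of the smaller set. *)
  have sub : tops (U i.+1) `<=` tops (tops (U i) `|` C i.+1).
    rewrite US => c [UCc top]; split.
      case: UCc => [Uc|]; last by right.
      by left; split => // c' Uc'; apply: top; left.
    by move=> c' [[Uc' _]|Cc']; apply: top; [left|right].
  apply: (le_trans (cost_le sub)).
  have := cost_tops_union (Ainc i) (covers_tops (UA i)) (HC i.+1).1 _ IH.
  rewrite (le_lt_trans (cA i)) ?ltry// => /(_ isT) /le_trans; apply.
  apply: (le_trans (leeD2r _ (HC i.+1).2)).
  by rewrite -addeA -EFinD [X in (_ <= _ + X%:E)%E]big_ord_recr/= addrC.
have sumei i : \sum_(j < i) ei j <= e.
  suff -> : \sum_(j < i) ei j = e - e / 2 ^+ i.
    by rewrite lerBlDr lerDl divr_ge0// ?exprn_ge0// ltW.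
  elim: i => [|i IH]; first by rewrite big_ord0 expr0 divr1 subrr.
  by rewrite big_ord_recr/= IH /ei exprS; field; rewrite expf_neq0.
pose U' := \bigcup_i C i.
apply: (@le_trans _ _ (cost (tops U'))).
  apply: content_le_cost; apply: covers_tops => x [i _] /(HC i).1[c Cc cx].
  by exists c => //; exists i.
apply: ge_ereal_sup => _ [F [finF FU]] <-.
(* An unordered sum is a supremum over finite subfamilies, and a finite subfamily of [U'] already
   lies in some [U i]. *)
have [i FUi] : exists i, F `<=` tops (U i).
  suff [i Fi] : exists i, F `<=` U i.
    exists i => c Fc; split; first exact: Fi.
    by move=> c' [j _ Cc']; apply: (FU _ Fc).2; exists j.
  have /finite_seqP[l Fl] := finF.
  have : forall c, c \in l -> U' c by move=> c cl; apply: (FU c _).1; rewrite Fl.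
  rewrite Fl => {FU Fl finF}; elim: l => [|c l IH] lU; first by exists 0%N.
  have [i Hi] : exists i, [set` l] `<=` U i.
    by apply: IH => c' c'l; apply: lU; rewrite inE c'l orbT.
  have [j _ Cjc] := lU c (mem_head _ _).
  exists (maxn i j) => c' /=; rewrite inE => /orP[/eqP->|/Hi[j' /= j'i Cj']].
    by exists j => //=; rewrite leq_maxr.
  by exists j' => //=; rewrite (leq_trans j'i)// leq_maxl.
apply: (@le_trans _ _ (cost (tops (U i)))).
  by apply: ereal_sup_ubound; exists F.
apply: (le_trans (topsU i)); apply: leeD; first exact: cA.
by rewrite lee_fin.
Qed.

End NetContent.

(** * Frostman weights on finitely many points *)

Section GreedyFrostman.
Context {R : realType} {E : Type} {L : choiceType}.
Variable lab : nat -> E -> L.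
Hypothesis lab_refine : forall i j x y, (i <= j)%N ->
  lab j x = lab j y -> lab i x = lab i y.
Variable wt : nat -> R.
Hypothesis wt_ge0 : forall j, 0 <= wt j.
Variables (x : nat -> E) (N : nat).

Definition mass (p : nat -> R) (n j : nat) (z : L) : R :=
  \sum_(i < n | lab j (x i) == z) p i.

Lemma massS p n j z : mass p n.+1 j z =
  mass p n j z + (if lab j (x n) == z then p n else 0).
Proof. by rewrite /mass big_mkcond big_ord_recr/= -big_mkcond. Qed.

(* Points are added one at a time, each with the largest weight that keeps every
   cell within its allowance; some cell containing the new point gets saturated. *)
Lemma greedy_weights n : exists p : nat -> R,
  [/\ forall i, 0 <= p i,
      forall j z, (j <= N)%N -> mass p n j z <= wt j &
      forall i, (i < n)%N -> exists2 j, (j <= N)%N & mass p n j (lab j (x i)) = wt j].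
Proof.
elim: n => [|n [p [p0 pub ptight]]].
  exists (fun=> 0); split => //= j z _; by rewrite /mass big_ord0.
pose room (j : 'I_N.+1) := wt j - mass p n j (lab j (x n)).
have [j0 _ j0min] := @Order.TotalTheory.arg_minP _ _ _ ord0 predT room isT.
pose q i := if i == n then room j0 else p i.
have massq j z : mass q n j z = mass p n j z.
  by apply: eq_bigr => i _; rewrite /q ltn_eqF.
have qn : q n = room j0 by rewrite /q eqxx.
exists q; split.
- move=> i; rewrite /q; case: ifP => // _.
  by rewrite subr_ge0 pub// -ltnS.
- move=> j z jN; rewrite massS massq; case: eqP => [<-|_]; last by rewrite addr0 pub.
  have jN' : (j < N.+1)%N by [].
  by have := j0min (Ordinal jN') isT; rewrite qn {2}/room /= lerBrDl.
- move=> i; rewrite ltnS leq_eqVlt => /orP[/eqP->|lin].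
    exists j0; first by rewrite -ltnS.
    by rewrite massS massq eqxx qn /room addrC subrK.
  have [j jN tight] := ptight _ lin.
  exists j => //; apply/le_anti/andP; split; last first.
    rewrite massS massq tight lerDl; case: ifP => // _.
    by rewrite qn subr_ge0 pub// -ltnS.
  rewrite massS massq; case: eqP => [<-|_]; last by rewrite addr0 pub.
  have jN' : (j < N.+1)%N by [].
  by have := j0min (Ordinal jN') isT; rewrite qn {2}/room /= lerBrDl.
Qed.

(** Each point lies in a saturated cell, which contains its whole cell of generation [N]. The
    maximal saturated cells are disjoint and each costs exactly its mass, so together they cost at
    most the total mass. *)
Lemma finite_frostman n : exists (p : nat -> R) (D : set (nat * L)),
  [/\ forall i, 0 <= p i,
      forall j z, (j <= N)%N -> mass p n j z <= wt j,
      forall c, D c -> (c.1 <= N)%N,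
      covers lab D [set y | exists2 i, (i < n)%N & lab N y = lab N (x i)] &
      (cost wt D <= (\sum_(i < n) p i)%:E)%E].
Proof.
have [p [p0 pub ptight]] := greedy_weights n.
pose D : set (nat * L) := [set c | (c.1 <= N)%N /\ mass p n c.1 c.2 = wt c.1].
exists p, (tops lab D); split => //.
- by move=> c [[]].
- apply: covers_tops => // y [i lin yi].
  have [j jN tight] := ptight i lin.
  exists (j, lab j (x i)) => //; exact: (lab_refine jN).
apply: ge_ereal_sup => _ [F [finF FD]] <-.
have /finite_fsetP[G FG] := finF.
rewrite FG fsbig_finite//= set_fsetK.
rewrite sumEFin lee_fin.
have -> : \sum_(c <- G) wt c.1 =
    \sum_(c <- G) \sum_(i < n) (if lab c.1 (x i) == c.2 then p i else 0).
  apply: eq_big_seq => c cG.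
  by rewrite -big_mkcond; have /FD[[_ <-] _] : F c by rewrite FG.
rewrite exchange_big/=; apply: ler_sum => i _.
have [[c cG cx]|H] := pselect (exists2 c, c \in G & lab c.1 (x i) = c.2).
  rewrite (bigD1_seq c)//= ?cx ?eqxx ?fset_uniq// big_seq_cond big1 ?addr0//.
  move=> c' /andP[c'G c'c]; case: eqP => // c'x; exfalso.
  have /FD[Dc tc] : F c by rewrite FG.
  have /FD[Dc' tc'] : F c' by rewrite FG.
  have [lt|lt|e] := ltngtP c.1 c'.1.
  - by apply: (tc' c Dc); apply: (above_of_mem lab_refine cx c'x lt).
  - by apply: (tc c' Dc'); apply: (above_of_mem lab_refine c'x cx lt).
  - by move/eqP: c'c; apply; rewrite (cell_inj cx c'x e).
rewrite big_seq big1 ?p0// => c cG; case: eqP => // cx.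
by exfalso; apply: H; exists c.
Qed.

End GreedyFrostman.

(** * Capacitability of Borel sets *)

Section Analytic.
Context {E : topologicalType}.
Implicit Types (A : set E) (Q : (nat -> nat) -> E -> Prop).

(* [Q] is closed in the product of the Baire space and [E]. *)
Definition closed_rel Q := forall s x, ~ Q s x ->
  exists n, \forall x' \near x, forall s', (forall i, (i < n)%N -> s' i = s i) -> ~ Q s' x'.

Definition analytic A := exists2 Q, closed_rel Q & A = [set x | exists s, Q s x].

Lemma analytic_closed A : closed A -> analytic A.
Proof.
move=> cA; exists (fun _ => A).
  move=> s x nAx; exists 0%N; have : nbhs x (~` A).
    by apply: open_nbhs_nbhs; split => //; rewrite openC.
  by apply: filterS => y nAy s' _.
by apply/seteqP; split => [x Ax|x []//]; exists (fun=> 0%N).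
Qed.

(** The first entry of the sequence names the set, the others form the witness. *)
Lemma analytic_bigcup (A : (set E)^nat) :
  (forall i, analytic (A i)) -> analytic (\bigcup_i A i).
Proof.
move=> aA; have /choice[Q HQ] : forall i, exists Q, closed_rel Q /\
    A i = [set x | exists s, Q s x] by move=> i; have [Q] := aA i; exists Q.
exists (fun s x => Q (s 0%N) (fun i => s i.+1) x).
  move=> s x /((HQ _).1)[n Hn]; exists n.+1; apply: filterS Hn => y Hy s' ss'.
  by rewrite ss'//; apply: Hy => i lin; rewrite ss'.
apply/seteqP; split => [x [i _]|x [s Qs]].
  rewrite (HQ i).2 => -[s Qs].
  by exists (fun j => if j is j'.+1 then s j' else i).
by exists (s 0%N) => //; rewrite (HQ _).2; exists (fun i => s i.+1).
Qed.

(** One sequence codes countably many witnesses through a pairing of indices. *)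
Lemma analytic_bigcap (A : (set E)^nat) :
  (forall i, analytic (A i)) -> analytic (\bigcap_i A i).
Proof.
move=> aA; have /choice[Q HQ] : forall i, exists Q, closed_rel Q /\
    A i = [set x | exists s, Q s x] by move=> i; have [Q] := aA i; exists Q.
exists (fun s x => forall i, Q i (fun j => s (choice.pickle (i, j))) x).
  move=> s x /existsNP[i /((HQ _).1)[n Hn]].
  exists (\max_(j < n) (choice.pickle (i, nat_of_ord j)).+1).
  apply: filterS Hn => y Hy s' ss' /(_ i); apply: Hy => j jn.
  apply: ss'; have := @leq_bigmax _ (fun j : 'I_n => (choice.pickle (i, nat_of_ord j)).+1).
  by move=> /(_ (Ordinal jn)).
apply/seteqP; split => [x Ax|x [s Qs] i _].
  have /choice[s Hs] : forall i, exists s, Q i s x.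
    by move=> i; have := Ax i I; rewrite (HQ i).2.
  exists (fun k => if @choice.unpickle (nat * nat)%type k is Some ij then s ij.1 ij.2 else 0%N).
  move=> i; rewrite (_ : (fun _ => _) = s i)//.
  by apply/funext => j; rewrite choice.pickleK.
by rewrite (HQ i).2; eexists; exact: Qs.
Qed.

(** Compactness of the product of the finite sets [{0, ..., b i}] in ultrafilter form: each bounded
    coordinate is constant on a member of [F], and a closed relation passes to the limit. *)
Lemma bounded_branch_ultra {J : Type} (F : set_system J) (Q : (nat -> nat) -> E -> Prop)
    (b : nat -> nat) (s : J -> nat -> nat) (x : J -> E) (p : E) :
  UltraFilter F -> closed_rel Q ->
  (forall U, nbhs p U -> F (x @^-1` U)) -> F [set j | Q (s j) (x j)] ->
  (forall i, F [set j | (s j i <= b i)%N]) ->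
  exists2 t, (forall i, (t i <= b i)%N) & Q t p.
Proof.
move=> FU cQ xp FQ Fb.
have /choice[t Ht] : forall i, exists v, (v <= b i)%N /\ F [set j | s j i = v].
  move=> i; have := Fb i; elim: (b i) => [|n IH] Fn.
    by exists 0%N; split => //; apply: filterS Fn => j /=; rewrite leqn0 => /eqP.
  have [Fv|Fv] := in_ultra_setVsetC [set j | s j i = n.+1] FU.
    by exists n.+1.
  have [v [vn Fv']] : exists v, (v <= n)%N /\ F [set j | s j i = v].
    apply: IH; apply: filterS (filterI Fn Fv) => j /= [].
    by rewrite leq_eqVlt ltnS => /orP[/eqP|].
  by exists v; split => //; exact: leqW.
exists t => [i|]; first exact: (Ht i).1.
apply: contrapT => /cQ[n Hn].
have Fn : F [set j | forall i, (i < n)%N -> s j i = t i].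
  elim: n {Hn} => [|n IH]; first by apply: filterS filterT.
  apply: filterS (filterI IH (Ht n).2) => j [/= H1 H2] i.
  by rewrite ltnS leq_eqVlt => /orP[/eqP->|/H1].
have FF : Filter F by exact: filter_filter.
have [j [[/= Hj1 Hj2] Hj3]] := filter_ex (filterI (filterI Fn (xp _ Hn) : F _) FQ : F _).
exact: (Hj2 _ Hj1 Hj3).
Qed.

End Analytic.

(** * Choquet capacitability for net contents *)

Section Capacitability.
Context {R : realType} {E : topologicalType} {L : choiceType}.
Variable lab : nat -> E -> L.
Hypothesis lab_refine : forall i j x y, (i <= j)%N ->
  lab j x = lab j y -> lab i x = lab i y.
Variable wt : nat -> R.
Hypothesis wt_ge0 : forall j, 0 <= wt j.

(** The entries of [b] are chosen one by one: raising the bound on the next entry gives an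
    increasing union, so by [content_bigcup] some finite bound keeps the content above [th]. *)
Lemma content_branch (Q : (nat -> nat) -> E -> Prop) (th : R) :
  (th%:E < content lab wt [set x | exists s, Q s x])%E ->
  exists b : nat -> nat, forall n,
  (th%:E < content lab wt
     [set x | exists2 s, (forall i, (i < n)%N -> (s i <= b i)%N) & Q s x])%E.
Proof.
move=> cA.
pose Ab (b : seq nat) := [set x | exists2 s,
  (forall i, (i < size b)%N -> (s i <= nth 0%N b i)%N) & Q s x].
pose T := {b : seq nat | (th%:E < content lab wt (Ab b))%E}.
have step (b : T) : exists v, (th%:E < content lab wt (Ab (rcons (sval b) v)))%E.
  apply: contrapT => H; have := svalP b; rewrite ltNge => /negP; apply.
  have -> : Ab (sval b) = \bigcup_v Ab (rcons (sval b) v).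
    apply/seteqP; split => [x [s sb Qs]|x [v _ [s sb Qs]]].
      exists (s (size (sval b))) => //; exists s => // i.
      rewrite size_rcons ltnS nth_rcons leq_eqVlt => /orP[/eqP->|ib].
        by rewrite ltnn eqxx.
      by rewrite ib sb.
    exists s => // i ib; have := sb i; rewrite size_rcons ltnS nth_rcons ib.
    by apply; exact: ltnW.
  apply: content_bigcup => // v; last by rewrite leNgt; apply/negP => Hv; apply: H; exists v.
  move=> x [s sb Qs]; exists s => // i; rewrite size_rcons => ib.
  have := sb i; rewrite size_rcons => /(_ ib) /leq_trans; apply.
  by rewrite !nth_rcons; case: ifP => // _; case: ifP.
have cA0 : (th%:E < content lab wt (Ab [::]))%E.
  apply: (lt_le_trans cA); apply: content_le => x [s Qs].
  by exists s.
have /choice[v Hv] := step.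
pose f (b : T) : T := exist _ (rcons (sval b) (v b)) (Hv b).
pose g n := iter n f (exist _ [::] cA0).
have szg n : size (sval (g n)) = n.
  by elim: n => // n IH; rewrite /= size_rcons IH.
exists (fun i => nth 0%N (sval (g i.+1)) i) => n.
have gpre i : (i < n)%N -> nth 0%N (sval (g n)) i = nth 0%N (sval (g i.+1)) i.
  elim: n => // n IH; rewrite ltnS leq_eqVlt => /orP[/eqP->//|lin].
  by rewrite -IH// /= nth_rcons szg lin.
apply: (lt_le_trans (svalP (g n))); apply: content_le => x [s sb Qs].
by exists s => // i lin; rewrite -gpre// sb// szg.
Qed.

(** [K] consists of the points with a witness bounded by [b] in every entry, while [content_branch]
    controls only finitely many entries at a time. Compactness carries the lower bound over to the
    open neighbourhoods of [K]. *)
Lemma analytic_compact_subset (A B : set E) (th : R) :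
  analytic A -> compact B -> A `<=` B -> (th%:E < content lab wt A)%E ->
  exists K, [/\ compact K, K `<=` A &
    forall U, open U -> K `<=` U -> (th%:E < content lab wt U)%E].
Proof.
move=> [Q cQ eA] cB AB cA.
have [b Hb] : exists b : nat -> nat, forall n, (th%:E < content lab wt
     [set x | exists2 s, (forall i, (i < n)%N -> (s i <= b i)%N) & Q s x])%E.
  by apply: content_branch; rewrite -eA.
pose K := [set x | exists2 s, (forall i, (s i <= b i)%N) & Q s x].
have KA : K `<=` A by move=> x [s _ Qs]; rewrite eA; exists s.
exists K; split => //.
  rewrite compact_ultra => F FU FK.
  have FF : Filter F by exact: filter_filter.
  have [p [_ Fp]] : B `&` [set p | F --> p] !=set0.
    by move: cB; rewrite compact_ultra; apply; apply: filterS FK => x /KA/AB.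
  have /choice[s Hs] : forall x, exists s, K x ->
      (forall i, (s i <= b i)%N) /\ Q s x.
    by move=> x; have [[s]|nK] := pselect (K x); [exists s|exists (fun=> 0%N)].
  exists p; split => //; apply: (bounded_branch_ultra (s := s) (x := id) FU cQ Fp).
    by apply: filterS FK => x /Hs[].
  by move=> i; apply: filterS FK => x /Hs[sb _] /=.
move=> U oU KU; apply: contrapT => cU.
(* If [U] had content at most [th], each finite stage would have a point outside [U]; an ultrafilter
   limit of these points lies in [K], so some of them lie in [U] after all. *)
have /choice[sx Hsx] : forall n, exists sx : (nat -> nat) * E,
    [/\ forall i, (i < n)%N -> (sx.1 i <= b i)%N, Q sx.1 sx.2 & ~ U sx.2].
  move=> n; apply: contrapT => H; apply: cU.
  apply: (lt_le_trans (Hb n)); apply: content_le => x [s sb Qs].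
  by apply: contrapT => nU; apply: H; exists (s, x).
have [F [FU Foo]] := ultraFilterLemma (eventually_filter).
have FF : Filter F by exact: filter_filter.
have [p [Bp clp]] : B `&` cluster ((fun n => (sx n).2) @ F) !=set0.
  apply: cB; apply: Foo; exists 0%N => // n _ /=; apply: AB; rewrite eA.
  by exists (sx n).1; have [] := Hsx n.
have Fp V : nbhs p V -> F [set n | V (sx n).2].
  move=> pV; have [//|FV] := in_ultra_setVsetC [set n | V (sx n).2] FU.
  have [y [nVy Vy]] := clp (~` V) V FV pV.
  by exfalso; exact: nVy Vy.
have [t tb Qt] : exists2 t, (forall i, (t i <= b i)%N) & Q t p.
  apply: (bounded_branch_ultra (s := fun n => (sx n).1) FU cQ Fp).
    by apply: Foo; exists 0%N => // n _; have [] := Hsx n.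
  move=> i; apply: Foo; exists i.+1 => // n ni; have [H _ _] := Hsx n.
  exact: H.
have : F [set n | U (sx n).2].
  by apply: Fp; apply: open_nbhs_nbhs; split => //; apply: KU; exists t.
move=> /filter_ex[n Un]; by have [] := Hsx n.
Qed.

End Capacitability.

Section Borel.
Context {R : realType} {m : nat}.

Lemma open_Fsigma (U : set 'rV[R]_m) : open U ->
  exists2 F : (set 'rV[R]_m)^nat, (forall i, closed (F i)) & U = \bigcup_i F i.
Proof.
move=> oU; exists (fun i => [set x | forall y, `|y - x| < i.+1%:R^-1 -> U y]).
  move=> i; rewrite -openC (_ : ~` _ = \bigcup_(y in ~` U) ball y i.+1%:R^-1).
    by apply: bigcup_open => y _; exact: ball_open.
  apply/seteqP; split => x /=.
    by move=> /existsNP[y /not_implyP[xy nUy]]; exists y => //; rewrite -ball_normE.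
  by move=> [y nUy]; rewrite -ball_normE /= => yx /(_ y yx).
apply/seteqP; split => [x Ux|x [i _ Hi]]; last by apply: Hi; rewrite subrr normr0 invr_gt0.
have /nbhs_ballP[e /= e0 eU] : nbhs x U by exact: open_nbhs_nbhs.
have [i ie] : exists i : nat, i.+1%:R^-1 < e.
  have [i _ /(_ i (leqnn _))] := near_infty_natSinv_lt (PosNum e0).
  by exists i.
exists i => // y xy; apply: eU; rewrite -ball_normE /= distrC.
exact: lt_trans ie.
Qed.

(** The sets that are analytic together with their complements form a sigma-algebra containing the
    open sets. *)
Lemma borel_analytic (A : set 'rV[R]_m) : borel A -> analytic A.
Proof.
pose G := [set A : set 'rV[R]_m | analytic A /\ analytic (~` A)].
suff H : borel `<=` G by move=> /H[].
apply: smallest_sub => /=; last first.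
  move=> U oU; split; last by apply: analytic_closed; rewrite closedC.
  have [F cF ->] := open_Fsigma oU; apply: analytic_bigcup => i.
  exact: analytic_closed.
split.
- by split; apply: analytic_closed; [exact: closed0|rewrite setC0; exact: closedT].
- by move=> A' [aA aA']; rewrite setTD; split; rewrite ?setCK.
- move=> F FG; split; first by apply: analytic_bigcup => i; have [] := FG i.
  by rewrite setC_bigcup; apply: analytic_bigcap => i; have [] := FG i.
Qed.

End Borel.

(** * Dyadic cells and Hausdorff measure *)

Section Norms.
Context {R : realType} {m : nat}.
Implicit Types x y : 'rV[R]_m.

Lemma coord_le_norm x i : `|x 0 i| <= `|x|.
Proof.
rewrite [leRHS]/Num.norm/= mx_normrE; apply/bigmax_geP; right.
by exists (0, i).
Qed.

Lemma norm_le_coord x r : 0 <= r -> (forall i, `|x 0 i| <= r) -> `|x| <= r.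
Proof.
move=> r0 xr; rewrite [leLHS]/Num.norm/= mx_normrE; apply/bigmax_leP; split => //.
by move=> [i j] _ /=; rewrite ord1.
Qed.

Lemma norm_le_enorm x : `|x| <= enorm x.
Proof.
apply: norm_le_coord; first exact: sqrtr_ge0.
move=> i; rewrite -sqrtr_sqr ler_sqrt ?sumr_ge0// => [|j _]; last exact: sqr_ge0.
by rewrite (bigD1 i)//= lerDl sumr_ge0// => j _; exact: sqr_ge0.
Qed.

Lemma enorm_le_norm x : enorm x <= m%:R * `|x|.
Proof.
have x0 : 0 <= m%:R * `|x| by rewrite mulr_ge0.
rewrite -[leRHS]ger0_norm// -sqrtr_sqr ler_sqrt ?sqr_ge0//.
apply: (@le_trans _ _ (\sum_(i < m) `|x| ^+ 2)).
  by apply: ler_sum => i _; rewrite -real_normK ?num_real// lerXn2r ?nnegrE// coord_le_norm.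
rewrite sumr_const card_ord -[leLHS]mulr_natl exprMn ler_wpM2r ?sqr_ge0//.
by rewrite -natrX ler_nat; case: (m) => // k; rewrite expnS leq_pmulr// expn_gt0.
Qed.

End Norms.

Section Dyadic.
Context {R : realType} {m : nat}.
Implicit Types (x y : 'rV[R]_m) (z : {ffun 'I_m -> int}).

Definition dyadic (j : nat) x : {ffun 'I_m -> int} :=
  [ffun i => Num.floor (2 ^+ j * x 0 i)].

Lemma floor_div_le (n : nat) (a b : R) : (0 < n)%N ->
  Num.floor (n%:R * a) = Num.floor (n%:R * b) -> Num.floor a <= Num.floor b.
Proof.
move=> n0 e; rewrite floor_ge_int -(ler_pM2l (_ : 0 < n%:R)) ?ltr0n//.
have -> : n%:R * (Num.floor a)%:~R = (n%:Z * Num.floor a)%:~R :> R by rewrite intrM.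
rewrite -floor_ge_int -e floor_ge_int intrM ler_pM2l ?ltr0n//.
exact: floor_le.
Qed.

Lemma dyadic_refine i j x y : (i <= j)%N ->
  dyadic j x = dyadic j y -> dyadic i x = dyadic i y.
Proof.
move=> ij /ffunP e; apply/ffunP => k; have := e k; rewrite !ffunE.
rewrite -(subnK ij) exprD -!mulrA -natrX => ek.
have n0 : (0 < 2 ^ (j - i))%N by rewrite expn_gt0.
by apply/le_anti; rewrite (floor_div_le n0 ek) (floor_div_le n0 (esym ek)).
Qed.

(** The shift by 1 makes the offsets [-1], [0] and [1], so [v] runs over the [3 ^ m] cells touching
    [z], itself included. *)
Definition neighbour z (v : {ffun 'I_m -> 'I_3}) : {ffun 'I_m -> int} :=
  [ffun i => z i + (v i)%:Z - 1].

Lemma floor_near (a b : R) : `|a - b| <= 1 ->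
  exists v : 'I_3, Num.floor a = Num.floor b + v%:Z - 1.
Proof.
rewrite ler_norml => /andP[h1 h2].
have := floor_itv a; have := floor_itv b.
rewrite !intrD => /andP[b1 b2] /andP[a1 a2].
have H1 : Num.floor a < Num.floor b + 2.
  by rewrite -(ltr_int R) intrD; lra.
have H2 : Num.floor b < Num.floor a + 2.
  by rewrite -(ltr_int R) intrD; lra.
have v3 : (`|(Num.floor a - Num.floor b + 1)%R|%N < 3)%N by lia.
by exists (Ordinal v3) => /=; lia.
Qed.

Lemma dyadic_near j x y : `|x - y| <= 2 ^- j ->
  exists v, dyadic j x = neighbour (dyadic j y) v.
Proof.
move=> xy.
have /choice[v Hv] : forall i : 'I_m, exists v : 'I_3,
    Num.floor (2 ^+ j * x 0 i) = Num.floor (2 ^+ j * y 0 i) + v%:Z - 1.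
  move=> i; apply: floor_near; rewrite -mulrBr normrM gtr0_norm ?exprn_gt0//.
  rewrite mulrC -ler_pdivlMr ?exprn_gt0// div1r.
  by apply: le_trans xy; have := coord_le_norm (x - y) i; rewrite !mxE.
by exists [ffun i => v i]; apply/ffunP => i; rewrite !ffunE.
Qed.

Lemma dyadic_dist j x y : dyadic j x = dyadic j y -> `|x - y| <= 2 ^- j.
Proof.
move=> /ffunP e; apply: norm_le_coord => [|i]; first by rewrite invr_ge0 exprn_ge0.
have := e i; rewrite !ffunE !mxE => ei.
have := floor_itv (2 ^+ j * x 0 i); rewrite ei => /andP[h1 h2].
have := floor_itv (2 ^+ j * y 0 i) => /andP[h3 h4].
rewrite -[leRHS]div1r ler_pdivlMr ?exprn_gt0// mulrC.
rewrite -[X in X * _]gtr0_norm ?exprn_gt0// -normrM mulrBr.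
move: h2 h4; rewrite !intrD => h2 h4.
by rewrite ler_norml; apply/andP; split; lra.
Qed.

End Dyadic.

Section HausdorffBasics.
Context {R : realType} {m : nat}.
Implicit Types A U : set 'rV[R]_m.

Lemma diam_ge0 U : U !=set0 -> (0 <= diam U)%E.
Proof.
move=> [x Ux]; apply: ereal_sup_ubound; exists x => //; exists x => //.
by rewrite subrr /enorm big1 ?sqrtr0// => i _; rewrite mxE expr0n.
Qed.

Lemma hausdorff_gauge_ge0 s U : (0 <= hausdorff_gauge s U)%E.
Proof. by rewrite /hausdorff_gauge; case: ifP => // _; exact: poweR_ge0. Qed.

Lemma hausdorff_gauge_le s U (d : R) : 0 <= s -> (diam U <= d%:E)%E ->
  (hausdorff_gauge s U <= (d `^ s)%:E)%E.
Proof.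
move=> s0 Ud; rewrite /hausdorff_gauge; case: ifPn => [_|/set0P U0].
  by rewrite lee_fin powR_ge0.
rewrite -poweR_EFin gt0_ler_poweR// in_itv/= leey andbT ?diam_ge0//.
exact: le_trans (diam_ge0 U0) Ud.
Qed.

Lemma hausdorff_premeasure_ge0 s d A : (0 <= hausdorff_premeasure s d A)%E.
Proof.
apply: le_ereal_inf_tmp => _ [U _ <-]; apply: nneseries_ge0 => n _ _.
exact: hausdorff_gauge_ge0.
Qed.

Lemma hausdorff_measure_eq0 s A :
  (forall d, 0 < d -> (hausdorff_premeasure s d A <= 0)%E) ->
  hausdorff_measure s A = 0%E.
Proof.
move=> H; apply/le_anti/andP; split.
  by apply: ge_ereal_sup => _ [d /= d0 <-]; exact: H.
apply: le_trans (hausdorff_premeasure_ge0 s 1 A) _.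
by apply: ereal_sup_ubound; exists 1 => /=.
Qed.

Lemma powR_geometric (s : R) j : (2 `^ (- s)) ^+ j = (2 ^- j) `^ s.
Proof.
by rewrite -powR_mulrn ?powR_ge0// -powRrM mulrC mulrN -mulNr powRrM powR_invn.
Qed.

Let wt (s : R) (j : nat) : R := (2 `^ (- s)) ^+ j.

Lemma dyadic_cell_diam (c : nat * {ffun 'I_m -> int}) :
  (diam (cell (@dyadic R m) c) <= (m%:R * 2 ^- c.1)%:E)%E.
Proof.
apply: ge_ereal_sup => _ [x cx [y cy <-]].
rewrite lee_fin (le_trans (enorm_le_norm _))// ler_wpM2l//.
by apply: dyadic_dist; rewrite cx cy.
Qed.

(** The content does not bound cell sizes, but as [0 < s] a small total cost makes every single cell
    small, so near-optimal covers are admissible at scale [d]. *)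
Lemma hausdorff_measure_content0 s A : 0 < s ->
  (content (@dyadic R m) (wt s) A <= 0)%E -> hausdorff_measure s A = 0%E.
Proof.
move=> s0 cA; apply: hausdorff_measure_eq0 => d d0.
apply/lee_addgt0Pr => e e0; rewrite add0e.
pose M : R := m%:R; have M0 : 0 <= M by [].
(* The first bound makes the total gauge at most [e]; the second forces diameter at most [d] on each
   cell of a cover of cost below [e']. *)
pose e' := Num.min (e / (M `^ s + 1)) ((d / (M + 1)) `^ s).
have Ms0 : 0 < M `^ s + 1 by rewrite ltr_wpDl// powR_ge0.
have e'0 : 0 < e' by rewrite lt_min divr_gt0//= powR_gt0// divr_gt0// ltr_wpDl.
have /ereal_inf_lt[_ [D DA <-] cD] : (content (@dyadic R m) (wt s) A < e'%:E)%E.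
  by apply: le_lt_trans cA _; rewrite lte_fin.
have wt0 s' j : 0 <= wt s' j by rewrite exprn_ge0// powR_ge0.
have De' c : D c -> wt s c.1 <= e'.
  move=> Dc; rewrite -lee_fin; apply: le_trans (ltW cD).
  rewrite -(@esum_set1 _ _ c (fun c => (wt s c.1)%:E)) ?lee_fin//.
  by apply: cost_le => // _ ->.
(* The family [D] is listed through its codes; all other indices get the empty set, whose gauge is
   0. *)
pose U i := if choice.pickle_inv i is Some c then
  (if c \in D then cell (@dyadic R m) c else set0) else set0.
have UP i : U i = set0 \/ exists2 c, D c & U i = cell (@dyadic R m) c.
  rewrite /U; case: choice.pickle_inv => [c|]; last by left.
  by case: ifPn => [/set_mem Dc|_]; [right; exists c|left].
apply: (@le_trans _ _ (\sum_(i <oo) hausdorff_gauge s (U i))%E).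
  apply: ereal_inf_lbound; exists U => //; split.
    move=> x /DA[c Dc cx]; exists (choice.pickle c) => //.
    by rewrite /U choice.pickleK_inv mem_set.
  move=> i; have [->|[c Dc ->]] := UP i.
    by apply: ge_ereal_sup => _ [x []].
  apply: (le_trans (dyadic_cell_diam c)); rewrite lee_fin.
  have le1 : 2 ^- c.1 <= d / (M + 1).
    rewrite leNgt; apply/negP => lt1.
    have := De' _ Dc; rewrite leNgt => /negP; apply.
    rewrite /wt powR_geometric; apply: (@le_lt_trans _ _ ((d / (M + 1)) `^ s)).
      by rewrite ge_min lexx orbT.
    by apply: gt0_ltr_powR => //; rewrite nnegrE ?invr_ge0 ?exprn_ge0// divr_ge0 ?addr_ge0// ltW.
  apply: (le_trans (ler_wpM2l M0 le1)).
  rewrite mulrCA ger_pMr// ler_pdivrMr ?mul1r ?lerDl//.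
  by rewrite ltr_wpDl.
pose f i : \bar R := if choice.pickle_inv i is Some c then
  (if c \in D then (wt s c.1)%:E else 0%E) else 0%E.
have f0 i : (0 <= f i)%E.
  by rewrite /f; case: choice.pickle_inv => [c|//]; case: ifP => // _; rewrite lee_fin.
apply: (@le_trans _ _ (\sum_(i <oo) (M `^ s)%:E * f i)%E).
  apply: lee_nneseries => [i _ _|i _]; first exact: hausdorff_gauge_ge0.
  rewrite /U /f; case: choice.pickle_inv => [c|]; last first.
    by rewrite /hausdorff_gauge eqxx mule0.
  case: ifP => _; last by rewrite /hausdorff_gauge eqxx mule0.
  apply: (le_trans (hausdorff_gauge_le (ltW s0) (dyadic_cell_diam c))).
  by rewrite powRM ?invr_ge0 ?exprn_ge0// /wt powR_geometric -EFinM.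
rewrite nneseriesZl => [|i _]; last exact: f0.
have -> : (\sum_(i <oo) f i = cost (wt s) D)%E.
  rewrite nneseries_esumT// /cost.
  rewrite (eq_esum (b := fun i =>
    if i \in [set choice.pickle c | c in D] then f i else 0%E)); last first.
    move=> i _; case: ifPn => // /negP nD; rewrite /f.
    case E : (choice.pickle_inv i) => [c|//].
    case: ifP => // /set_mem Dc; exfalso; apply: nD; apply/mem_set.
    by exists c => //; have := @choice.pickle_invK (nat * {ffun 'I_m -> int})%type i; rewrite E.
  rewrite -esum_mkcond esum_image; last first.
    by move=> c c' _ _; exact: (pcan_inj choice.pickleK_inv).
  by apply: eq_esum => c Dc; rewrite /f choice.pickleK_inv mem_set.
apply: (@le_trans _ _ ((M `^ s)%:E * e'%:E)%E).
  by apply: lee_wpmul2l; [rewrite lee_fin powR_ge0|exact: ltW].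
rewrite -EFinM lee_fin; apply: (@le_trans _ _ (M `^ s * (e / (M `^ s + 1)))).
  by rewrite ler_wpM2l ?powR_ge0// ge_min lexx.
by rewrite mulrCA ger_pMr// ler_pdivrMr// mul1r lerDl.
Qed.

End HausdorffBasics.

(** * Discrete Frostman measures *)

Section Energy.
Context {R : realType} {m : nat}.
Local Notation cellT := (nat * {ffun 'I_m -> int})%type.
Local Notation dy := (@dyadic R m).
Let c3 : R := #|{ffun 'I_m -> 'I_3}|%:R.

Lemma geometric_sum_le (q : R) n : 0 <= q < 1 -> \sum_(j < n) q ^+ j <= (1 - q)^-1.
Proof.
move=> /andP[q0 q1]; have d0 : 0 < 1 - q by rewrite subr_gt0.
suff -> : \sum_(j < n) q ^+ j = (1 - q ^+ n) / (1 - q).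
  by rewrite ler_pdivrMr// mulVf ?gt_eqF// lerBlDr lerDl exprn_ge0.
elim: n => [|n IH]; first by rewrite big_ord0 expr0 subrr mul0r.
by rewrite big_ord_recr/= IH exprS; field; rewrite gt_eqF.
Qed.

(** A fixed offset moves cells injectively within their generation, so each of the [c3] offsets
    contributes one copy of the cost. *)
Lemma cost_neighbours (wt : nat -> R) (D : set cellT) (r : R) :
  (forall j, 0 <= wt j) -> (cost wt D <= r%:E)%E ->
  (cost wt [set c | exists2 c', D c' & exists v, c = (c'.1, neighbour c'.2 v)]
    <= (c3 * r)%:E)%E.
Proof.
move=> wt0 Dr.
pose Dv (v : {ffun 'I_m -> 'I_3}) : set cellT := [set (c.1, neighbour c.2 v) | c in D].
have costDv v : cost wt (Dv v) = cost wt D.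
  have inj : set_inj D (fun c : cellT => (c.1, neighbour c.2 v)).
    move=> [i z] [i' z'] _ _ [-> /ffunP e].
    by congr (_, _); apply/ffunP => k; have := e k; rewrite !ffunE => /addIr/addIr.
  by rewrite /cost esum_image.
have cU (l : seq {ffun 'I_m -> 'I_3}) :
    (cost wt [set c | exists2 v, v \in l & Dv v c] <= ((size l)%:R * r)%:E)%E.
  elim: l => [|u l IH].
    rewrite mul0r; apply: le_trans (_ : cost wt set0 <= 0)%E.
      by apply: cost_le => // c [].
    by rewrite /cost esum_set0.
  rewrite -natr1 mulrDl mul1r EFinD.
  apply: le_trans (leeD IH (_ : cost wt (Dv u) <= r%:E)%E); last by rewrite costDv.
  apply: le_trans (costU wt0 _ _).
  apply: cost_le => // c [w]; rewrite inE => /orP[/eqP->|wl] cw; [by right|left].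
  by exists w.
rewrite /c3 cardE; apply: le_trans (cU _).
apply: cost_le => // c [c' Dc' [v ->]]; exists v; first by rewrite mem_enum.
by exists c'.
Qed.

(** The atoms are the centres of a finite cover of [K] by balls of radius [2 ^- N]. Saturated cells
    have generation at most [N], so with their neighbours they cover these balls, an open
    neighbourhood of [K] whose content exceeds [th]. *)
Lemma compact_frostman (wt : nat -> R) (K : set 'rV[R]_m) (th : R) (N : nat) :
  (forall j, 0 <= wt j) -> compact K ->
  (forall U, open U -> K `<=` U -> (th%:E < content dy wt U)%E) ->
  exists n (x : nat -> 'rV[R]_m) (p : nat -> R),
  [/\ forall i, (i < n)%N -> K (x i), forall i, 0 <= p i,
      forall j z, (j <= N)%N -> mass dy x p n j z <= wt j &
      th <= c3 * \sum_(i < n) p i].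
Proof.
move=> wt0 cK Kth.
have [G GK KG] : finite_subset_cover K (fun x => ball x (2 ^- N)) K.
  move: cK; rewrite compact_cover; apply=> [x _|x Kx]; first exact: ball_open.
  by exists x => //; apply: ballxx; rewrite invr_gt0 exprn_gt0.
pose x i := nth 0 (enum_fset G) i; pose n := size (enum_fset G).
have [p [D [p0 pm DN Dcov Dcost]]] := finite_frostman (@dyadic_refine R m) wt0 x N n.
exists n, x, p; split => //.
  by move=> i lin; apply/set_mem/GK/mem_nth.
rewrite -lee_fin; apply: le_trans (cost_neighbours wt0 Dcost).
have Gopen : open (cover [set` G] (fun x => ball x (2 ^- N))).
  by apply: bigcup_open => y _; exact: ball_open.
apply: (le_trans (ltW (Kth _ Gopen KG))).
apply: content_le_cost => y [z /= zG]; rewrite -ball_normE /= => yz.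
have zx : x (index z (enum_fset G)) = z by rewrite /x nth_index.
have [c Dc cz] : exists2 c, D c & cell dy c z.
  by apply: Dcov; exists (index z (enum_fset G)); rewrite ?zx// index_mem.
have [v yv] : exists v, dy c.1 y = neighbour (dy c.1 z) v.
  apply: dyadic_near; rewrite distrC (le_trans (ltW yz))// ler_pV2 ?inE ?unitfE ?gt_eqF ?exprn_gt0//.
  by rewrite ler_eXn2l ?ltr1n// DN.
exists (c.1, neighbour c.2 v); first by exists c => //; exists v.
by rewrite /cell /= yv cz.
Qed.

(** Dyadic layers: for [z] between [2 ^- j.+1] and [2 ^- j] the [j]-th term alone dominates the
    kernel, hence its exponent [j.+1]; the leading 1 serves [z >= 1]. *)
Lemma kernel_le_sum (s : R) (N : nat) (z : R) : 0 <= s -> 0 <= z ->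
  Num.max z (2 ^- N) `^ (- s) <=
    1 + \sum_(j < N) (if z <= 2 ^- j then (2 `^ s) ^+ j.+1 else 0).
Proof.
move=> s0 z0; elim: N => [|N IH].
  rewrite big_ord0 addr0 expr0 invr1 powRN invf_le1 ?powR_gt0 ?lt_max ?ltr01 ?orbT//.
  by rewrite -[leLHS](powRr0 (Num.max z 1)) ler_powR// le_max lexx orbT.
rewrite big_ord_recr/=; case: (leP z (2 ^- N)) => zN; last first.
  rewrite addr0; apply: le_trans IH; rewrite !max_l//; first exact: ltW.
  apply: le_trans (ltW zN); rewrite ler_pV2 ?inE ?unitfE ?gt_eqF ?exprn_gt0//.
  by rewrite ler_eXn2l ?ltr1n.
rewrite addrA; apply: ler_wpDl.
  by rewrite addr_ge0// sumr_ge0// => j _; case: ifP => // _; rewrite exprn_ge0 ?powR_ge0.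
have p0 : 0 < 2 ^- N.+1 :> R by rewrite invr_gt0 exprn_gt0.
apply: (@le_trans _ _ ((2 ^- N.+1) `^ (- s))).
  rewrite !powRN lef_pV2 ?posrE ?powR_gt0 ?lt_max ?p0 ?orbT//.
  by rewrite ge0_ler_powR// ?nnegrE ?le_max ?lexx ?(ltW p0) ?orbT.
by rewrite -powR_geometric opprK.
Qed.

(** A ball of radius [2 ^- j] meets only the neighbours of the cell of its centre. *)
Lemma near_mass (x : nat -> 'rV[R]_m) (p : nat -> R) n j (y : 'rV[R]_m) (b : R) :
  (forall i, 0 <= p i) -> (forall z, mass dy x p n j z <= b) ->
  \sum_(i < n) (if `|x i - y| <= 2 ^- j then p i else 0) <= c3 * b.
Proof.
move=> p0 pb.
apply: (@le_trans _ _ (\sum_(v : {ffun 'I_m -> 'I_3}) mass dy x p n j (neighbour (dy j y) v))).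
  rewrite /mass; under [leRHS]eq_bigr do rewrite big_mkcond.
  rewrite exchange_big; apply: ler_sum => i _; case: ifPn => [|_]; last first.
    by rewrite sumr_ge0// => v _; case: ifP.
  move=> /dyadic_near[v ->]; rewrite (bigD1 v)//= eqxx lerDl sumr_ge0// => w _.
  by case: ifP.
apply: le_trans (ler_sum _ (fun v _ => pb _)) _.
by rewrite sumr_const -mulr_natl.
Qed.

(** Layer [j] has mass at most a constant times [2 ^ (- s j)] and weight a constant times
    [2 ^ (t j)]; as [t < s], the geometric series gives a bound free of [N]. *)
Lemma discrete_energy_le (s t B : R) (x : nat -> 'rV[R]_m) (p : nat -> R) (n N : nat) :
  0 <= t < s -> 0 <= B -> (forall i, 0 <= p i) -> \sum_(i < n) p i = 1 ->
  (forall j z, (j <= N)%N -> mass dy x p n j z <= B * (2 `^ (- s)) ^+ j) ->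
  \sum_(i < n) \sum_(i' < n) p i * p i' * Num.max `|x i - x i'| (2 ^- N) `^ (- t)
  <= 1 + 2 `^ t * (c3 * B) / (1 - 2 `^ (t - s)).
Proof.
move=> /andP[t0 ts] B0 p0 p1 pm; set C := leRHS.
rewrite -[C]mul1r -[X in _ <= X * C]p1 mulr_suml; apply: ler_sum => i _.
under eq_bigr do rewrite -mulrA; rewrite -mulr_sumr ler_wpM2l//.
apply: (@le_trans _ _ (\sum_(i' < n) (p i' + \sum_(j < N)
   (2 `^ t) ^+ j.+1 * (if `|x i' - x i| <= 2 ^- j then p i' else 0)))).
  apply: ler_sum => i' _; rewrite distrC.
  apply: (le_trans (ler_wpM2l (p0 _) (kernel_le_sum N t0 (normr_ge0 _)))).
  rewrite mulrDr mulr1 lerD2l mulr_sumr; apply: ler_sum => j _.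
  by case: ifP => _; rewrite ?mulr0// mulrC.
rewrite big_split/= p1 lerD2l exchange_big/=.
apply: (@le_trans _ _ (\sum_(j < N) 2 `^ t * (c3 * B) * (2 `^ (t - s)) ^+ j)).
  apply: ler_sum => j _; rewrite -mulr_sumr.
  have -> : 2 `^ t * (c3 * B) * (2 `^ (t - s)) ^+ j =
     (2 `^ t) ^+ j.+1 * (c3 * (B * (2 `^ (- s)) ^+ j)).
    by rewrite powRD ?pnatr_eq0 ?implybT// exprMn exprS; ring.
  rewrite ler_wpM2l ?exprn_ge0 ?powR_ge0//.
  apply: near_mass => // z; apply: pm; exact: ltnW.
rewrite -mulr_sumr ler_wpM2l ?mulr_ge0 ?powR_ge0//.
apply: geometric_sum_le; rewrite powR_ge0/=.
by rewrite -[ltRHS](powRr0 2) /powR pnatr_eq0/= ltr_expR ltr_pM2r ?subr_lt0// ln_gt0// ltr1n.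
Qed.

End Energy.

Section DiscreteFrostman.
Context {R : realType} {m : nat}.

(* Stands in for a probability measure on [K] of finite [t]-energy: the measures
   depend on the truncation scale [e], but [C] does not. *)
Definition finite_energy (K : set 'rV[R]_m) (t C : R) : Prop :=
  forall e, 0 < e -> exists n (x : nat -> 'rV[R]_m) (p : nat -> R),
  [/\ forall i, (i < n)%N -> K (x i), forall i, 0 <= p i, \sum_(i < n) p i = 1 &
     \sum_(i < n) \sum_(i' < n)
       p i * p i' * Num.max `|x i - x i'| e `^ (- t) <= C].

Lemma lt_ereal_between (a : R) (b : \bar R) : (a%:E < b)%E ->
  exists2 c, a < c & (c%:E < b)%E.
Proof.
case: b => [b| |//]; last by exists (a + 1); rewrite ?ltrDl// ltry.
rewrite lte_fin => ab; exists ((a + b) / 2); first by rewrite ltr_pdivlMr//; lra.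
by rewrite lte_fin ltr_pdivrMr//; lra.
Qed.

Lemma expN2_le (e : R) : 0 < e -> exists N : nat, 2 ^- N <= e.
Proof.
move=> e0; exists (Num.truncn e^-1).+1.
rewrite -[leRHS]invrK lef_pV2 ?posrE ?invr_gt0 ?exprn_gt0//.
apply: le_trans (ltW (truncnS_gt _)) _.
by rewrite -natrX ler_nat ltnW// ltn_expl.
Qed.

Lemma compact_finite_energy (K : set 'rV[R]_m) (s t th : R) :
  0 <= t < s -> 0 < th -> compact K ->
  (forall U, open U -> K `<=` U ->
    (th%:E < content (@dyadic R m) (fun j => ((2 `^ (- s)) ^+ j)%R) U)%E) ->
  exists C, finite_energy K t C.
Proof.
move=> ts th0 cK Kth.
pose c3 : R := #|{ffun 'I_m -> 'I_3}|%:R.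
(* The total mass is at least [th / c3], so normalising multiplies the masses by at most [B],
   whatever the scale. *)
pose B := c3 / th.
exists (1 + 2 `^ t * (c3 * B) / (1 - 2 `^ (t - s))) => e e0.
have [N Ne] := expN2_le e0.
have wt0 j : 0 <= (2 `^ (- s)) ^+ j by rewrite exprn_ge0// powR_ge0.
have [n [x [p [xK p0 pm thp]]]] := compact_frostman N wt0 cK Kth.
pose S := \sum_(i < n) p i.
have c30 : 0 <= c3 by [].
have S0 : 0 < S.
  have : 0 < c3 * S by exact: lt_le_trans thp.
  by rewrite pmulr_rgt0// lt_def c30 andbT; apply/eqP => c3E; move: thp; rewrite -/c3 c3E mul0r leNgt th0.
have SB : S^-1 <= B.
  by rewrite /B -[leLHS]mul1r ler_pdivrMr// mulrAC ler_pdivlMr// mul1r.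
pose q i := p i / S.
have q0 i : 0 <= q i by rewrite divr_ge0// ltW.
have q1 : \sum_(i < n) q i = 1 by rewrite -mulr_suml divff// gt_eqF.
exists n, x, q; split => //.
have B0 : 0 <= B by rewrite divr_ge0// ltW.
have qm j z : (j <= N)%N -> mass (@dyadic R m) x q n j z <= B * (2 `^ (- s)) ^+ j.
  move=> jN; rewrite /mass -mulr_suml mulrC; apply: ler_pM => //.
  - by rewrite invr_ge0 ltW.
  - by rewrite sumr_ge0.
  - exact: pm.
apply: le_trans (discrete_energy_le ts B0 q0 q1 qm).
apply: ler_sum => i _; apply: ler_sum => i' _; apply: ler_wpM2l; first by rewrite mulr_ge0.
have /andP[t0 _] := ts.
have N0 : 0 < 2 ^- N :> R by rewrite invr_gt0 exprn_gt0.
rewrite !powRN lef_pV2 ?posrE ?powR_gt0 ?lt_max ?N0 ?e0 ?orbT//.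
apply: ge0_ler_powR => //; last by rewrite ge_max !le_max lexx Ne orbT.
  by rewrite nnegrE le_max normr_ge0.
by rewrite nnegrE le_max normr_ge0.
Qed.

(** The alternative [t = 0] admits sets of dimension 0, through a point mass of energy 1. *)
Lemma discrete_frostman (X : set 'rV[R]_m) (t : R) :
  borel X -> X !=set0 -> 0 <= t -> t = 0 \/ (t%:E < hausdorff_dim X)%E ->
  exists K C, [/\ compact K, K `<=` X & finite_energy K t C].
Proof.
move=> bX [x0 Xx0] t0 [->|tX].
  exists [set x0], 1; split => //; first exact: compact_set1.
    by move=> _ ->.
  move=> e e0; exists 1%N, (fun=> x0), (fun=> 1); split => //; first by rewrite big_ord1.
  by rewrite big_ord1 big_ord1 oppr0 powRr0 !mul1r.
have [s ts sX] := lt_ereal_between tX.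
have s0 : 0 < s by exact: le_lt_trans ts.
pose wt j : R := (2 `^ (- s)) ^+ j.
have wt0 j : 0 <= wt j by rewrite exprn_ge0// powR_ge0.
pose box M : set 'rV[R]_m := [set x | `|x| <= M%:R].
have cbox M : compact (box M).
  apply: bounded_closed_compact.
    by exists M%:R; split => // y My x /le_trans; apply; exact: ltW.
  rewrite (_ : box M = closed_ball_ Num.norm 0 M%:R); first exact: closed_closed_ball_.
  by apply/seteqP; split => x /=; rewrite /closed_ball_ /= sub0r normrN.
have [M HM] : exists M, (0%:E < content (@dyadic R m) wt (X `&` box M))%E.
  (* If all bounded pieces had content zero, so would [X] by [content_bigcup], and its dimension
     would be at most [s]. *)
  apply: contrapT => H; move: sX; rewrite ltNge => /negP; apply.
  apply: ereal_inf_lbound; exists s => //; split; first exact: ltW.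
  apply: hausdorff_measure_content0 => //.
  have -> : X = \bigcup_M (X `&` box M).
    rewrite -setI_bigcupr; apply/seteqP; split => [x Xx|x []//]; split => //.
    by exists (Num.truncn `|x|).+1 => //; exact: ltW (truncnS_gt _).
  apply: content_bigcup => //; first exact: dyadic_refine.
    by move=> M x [Xx /= xM]; split => //; apply: (le_trans xM); rewrite ler_nat.
  by move=> M; rewrite leNgt; apply/negP => HM; apply: H; exists M.
have [th th0 Hth] := lt_ereal_between HM.
have aX : analytic (X `&` box M).
  rewrite (_ : _ `&` _ = \bigcap_i (if i is 0%N then X else box M)).
    apply: analytic_bigcap => -[|i]; first exact: borel_analytic.
    apply: analytic_closed; apply: compact_closed => //; exact: norm_hausdorff.
  apply/seteqP; split => [x [Xx Mx] [|i] _//|x H]; split; first exact: (H 0%N I).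
  exact: (H 1%N I).
have [K [cK KX KU]] := analytic_compact_subset (@dyadic_refine R m) wt0 aX (cbox M)
  (@subIsetr _ _ _) Hth.
have ts' : 0 <= t < s by rewrite t0 ts.
have [C HC] := compact_finite_energy ts' th0 cK KU.
by exists K, C; split => // x /KX[].
Qed.

End DiscreteFrostman.

(** * Small ball estimates *)

Section NormalEstimates.
Context {R : realType}.
Local Notation mu := (@lebesgue_measure R).
Implicit Types (s a t : R).

Lemma ge0_integral_normal_prob s (f : R -> \bar R) :
  measurable_fun setT f -> (forall x, 0 <= f x)%E ->
  (\int[normal_prob 0 s]_x f x = \int[mu]_x (f x * (normal_pdf 0 s x)%:E))%E.
Proof.
move=> mf f0; have dom := normal_prob_dominates 0 s.
rewrite -(Radon_Nikodym_SigmaFinite.change_of_variables dom f0)//.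
have ig := Radon_Nikodym_SigmaFinite.f_integrable dom.
have mpdf : measurable_fun setT (fun x => (normal_pdf 0 s x)%:E).
  by apply/measurable_EFinP; exact: measurable_normal_pdf.
apply: ae_eq_integral => //.
- by apply: emeasurable_funM => //; exact: measurable_int ig.
- exact: emeasurable_funM.
apply: ae_eqe_mul2l; apply: integral_ae_eq => // E _ mE.
by rewrite -Radon_Nikodym_SigmaFinite.f_integral.
Qed.

(* Comparing with the doubled deviation bounds the second moment without
   computing it; only its order of magnitude matters. *)
Lemma normal_pdf_sqr_le s x : s != 0 ->
  x ^+ 2 * normal_pdf 0 s x <= 8 * s ^+ 2 * normal_pdf 0 (2 * s) x.
Proof.
move=> s0; have s20 : 0 < s ^+ 2 by rewrite exprn_even_gt0.
rewrite !normal_pdfE ?mulf_neq0//.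
have -> : normal_peak (2 * s) = normal_peak s / 2.
  rewrite /normal_peak -invfM; congr (_^-1).
  have -> : (2 * s) ^+ 2 * pi *+ 2 = 2 ^+ 2 * (s ^+ 2 * pi *+ 2) :> R by ring.
  by rewrite sqrtrM// sqrtr_sqr ger0_norm// mulrC.
rewrite /normal_fun !subr0.
set u := x ^+ 2; set S := s ^+ 2.
have u0 : 0 <= u by exact: sqr_ge0.
(* The difference of the two exponents; [v <= expR v] then bounds [u * expR (- v)]. *)
pose v := 3 * u / (8 * S).
have v0 : 0 <= v by rewrite divr_ge0// mulr_ge0// ltW.
have -> : expR (- u / (S *+ 2)) = expR (- u / ((2 * s) ^+ 2 *+ 2)) * expR (- v).
  rewrite -expRD; congr expR; rewrite exprMn -/S /v; field.
  by rewrite gt_eqF.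
have ev : u * expR (- v) <= 4 * S.
  rewrite expRN ler_pdivrMr ?expR_gt0//.
  have := expR_ge1Dx v => h.
  apply: (@le_trans _ _ (4 * S * v)); last first.
    by apply: ler_wpM2l; [rewrite mulr_ge0// ltW|apply: le_trans h; rewrite lerDr].
  by rewrite /v (_ : 4 * S * (3 * u / (8 * S)) = 3 / 2 * u); [lra|field; rewrite gt_eqF].
have -> : u * (normal_peak s * (expR (- u / ((2 * s) ^+ 2 *+ 2)) * expR (- v))) =
  normal_peak s * expR (- u / ((2 * s) ^+ 2 *+ 2)) * (u * expR (- v)) by ring.
have -> : 8 * S * (normal_peak s / 2 * expR (- u / ((2 * s) ^+ 2 *+ 2))) =
  normal_peak s * expR (- u / ((2 * s) ^+ 2 *+ 2)) * (4 * S) by field.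
by rewrite ler_wpM2l// mulr_ge0 ?normal_peak_ge0 ?expR_ge0.
Qed.

Lemma normal_second_moment_le s : s != 0 ->
  (\int[normal_prob 0 s]_x (x ^+ 2)%:E <= (8 * s ^+ 2)%:E)%E.
Proof.
move=> s0.
have msq : measurable_fun setT (fun x : R => (x ^+ 2)%:E).
  by apply/measurable_EFinP; exact: measurable_funX.
rewrite ge0_integral_normal_prob// => [|x]; last by rewrite lee_fin sqr_ge0.
apply: (@le_trans _ _ (\int[mu]_x ((8 * s ^+ 2)%:E * (normal_pdf 0 (2 * s) x)%:E))%E).
  apply: ge0_le_integral => //.
  - by move=> x _; rewrite lee_fin mulr_ge0 ?sqr_ge0// normal_pdf_ge0.
  - apply: emeasurable_funM => //.
    by apply/measurable_EFinP; exact: measurable_normal_pdf.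
  - apply: emeasurable_funM => //.
    by apply/measurable_EFinP; exact: measurable_normal_pdf.
  - by move=> x _; rewrite -!EFinM lee_fin normal_pdf_sqr_le.
rewrite ge0_integralZl_EFin//.
- by rewrite integral_normal_pdf mule1.
- by move=> x _; rewrite lee_fin normal_pdf_ge0.
- by apply/measurable_EFinP; exact: measurable_normal_pdf.
- by rewrite mulr_ge0// sqr_ge0.
Qed.

Lemma normal_prob_le s (A : set R) (a r M : R) : s != 0 -> measurable A ->
  A `<=` `[a - r, a + r] -> 0 <= r -> 0 <= M -> (forall x, A x -> normal_pdf 0 s x <= M) ->
  (normal_prob 0 s A <= (2 * r * M)%:E)%E.
Proof.
move=> s0 mA Aar r0 M0 AM.
apply: (@le_trans _ _ (\int[mu]_(x in A) M%:E)%E).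
  apply: ge0_le_integral => //.
  - by move=> x _; rewrite lee_fin normal_pdf_ge0.
  - apply: measurable_funTS; apply/measurable_EFinP; exact: measurable_normal_pdf.
rewrite integral_cst//.
apply: (@le_trans _ _ (M%:E * mu (`[(a - r)%R, (a + r)%R]%classic : set R))%E).
  apply: lee_wpmul2l; first by rewrite lee_fin.
  apply: le_measure => //; apply/mem_set => //; exact: measurable_itv.
rewrite lebesgue_measure_itv/=; case: ifPn => _; last by rewrite mule0 lee_fin !mulr_ge0.
by rewrite -EFinD -EFinM lee_fin le_eqVlt; apply/orP; left; apply/eqP; ring.
Qed.

(** The peak is at most [1 / (2 |s|)] because [2 <= pi]. *)
Lemma normal_pdf_tail s t x : s != 0 -> 0 <= t -> t <= `|x| ->
  normal_pdf 0 s x <= 2^-1 * `|s|^-1 * expR (- (t ^+ 2 / (2 * s ^+ 2))).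
Proof.
move=> s0 t0 tx; have s20 : 0 < s ^+ 2 by rewrite exprn_even_gt0.
rewrite normal_pdfE//; apply: ler_pM; rewrite ?normal_peak_ge0 ?expR_ge0//.
  rewrite /normal_peak -invfM lef_pV2 ?posrE ?mulr_gt0 ?normr_gt0//; last first.
    by rewrite sqrtr_gt0 mulrn_wgt0// mulr_gt0// pi_gt0.
  rewrite -[leLHS]ger0_norm// -sqrtr_sqr ler_sqrt; last first.
    by rewrite mulrn_wge0// mulr_ge0 ?sqr_ge0// pi_ge0.
  rewrite exprMn real_normK ?num_real//.
  have := @pi_ge2 R => pi2; rewrite -mulrnAr mulrC ler_wpM2l ?sqr_ge0//; lra.
rewrite /normal_fun subr0 ler_expR mulNr lerN2 (_ : s ^+ 2 *+ 2 = 2 * s ^+ 2); last by ring.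
apply: ler_wpM2r; first by rewrite invr_ge0 mulr_ge0// ltW.
by rewrite -[leRHS]real_normK ?num_real// lerXn2r ?nnegrE.
Qed.

End NormalEstimates.

(** * Gaussian variables of known variance *)

Section GaussianIncrement.
Context {R : realType} {dT : measure_display} {T : measurableType dT}.
Variable P : probability T R.
Variables (Z : T -> R) (sg : R).
Hypothesis gZ : centred_gaussian P Z.
Hypothesis sg0 : 0 < sg.
Hypothesis EZ : ('E_P[fun w => (`|Z w| ^+ 2)%R] = (sg ^+ 2)%:E)%E.

Let mZ : measurable_fun setT Z. Proof. by case: gZ. Qed.

Lemma centred_gaussian_moment : (\int[P]_w (Z w ^+ 2)%:E = (sg ^+ 2)%:E)%E.
Proof.
rewrite -EZ expectation.unlock; apply: eq_integral => w _.
by rewrite real_normK// num_real.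
Qed.

Lemma centred_gaussian_moment_law (nu : {measure set (measurableTypeR R) -> \bar R}) :
  (forall A : set R, measurable A -> P (Z @^-1` A) = nu A) ->
  (\int[nu]_x (x ^+ 2)%:E = (sg ^+ 2)%:E)%E.
Proof.
move=> Pnu; rewrite -centred_gaussian_moment.
have msq : measurable_fun setT (fun x : R => (x ^+ 2)%:E).
  by apply/measurable_EFinP; exact: measurable_funX.
transitivity (\int[pushforward P (Z : T -> measurableTypeR R)]_x (x ^+ 2)%:E)%E.
  by apply: eq_measure_integral => A mA _; rewrite -Pnu.
rewrite ge0_integral_pushforward //.
by move=> x _; rewrite lee_fin sqr_ge0.
Qed.

(** [s] parametrises the law while [sg] is known from the second moment; comparability suffices. One
    side is [sg ^ 2 <= 8 s ^ 2]; for the other, [|Z| > |s| / 2] has probability at least one half,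
    so [s ^ 2 / 8 <= sg ^ 2]. *)
Lemma centred_gaussian_scale : exists s, [/\ s != 0, sg <= 3 * `|s|, `|s| <= 3 * sg &
  forall A, measurable A -> P (Z @^-1` A) = normal_prob 0 s A].
Proof.
have [_ [s Ps]] := gZ; exists s.
have s0 : s != 0.
  apply/eqP => s0; have : (\int[\d_(0%R : measurableTypeR R)]_x (x ^+ 2)%:E = (sg ^+ 2)%:E)%E.
    by apply: centred_gaussian_moment_law => A mA; rewrite Ps// /gaussian_law s0 eqxx.
  rewrite integral_dirac//=; last by apply/measurable_EFinP; exact: measurable_funX.
  rewrite expr0n/= mule0 => -[] /esym/eqP.
  by rewrite sqrf_eq0 gt_eqF.
have Pn A : measurable A -> P (Z @^-1` A) = normal_prob 0 s A.
  by move=> mA; rewrite Ps// /gaussian_law (negbTE s0).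
have s20 : 0 < s ^+ 2 by rewrite exprn_even_gt0.
split => //.
  have := normal_second_moment_le s0; rewrite (centred_gaussian_moment_law (nu := normal_prob 0 s) Pn) lee_fin => h.
  rewrite -ler_sqr ?nnegrE ?mulr_ge0 ?(ltW sg0)// exprMn real_normK ?num_real//.
  by apply: le_trans h _; lra.
pose A : set R := `[(- (`|s| / 2))%R, (`|s| / 2)%R]%classic.
have PA : (P (Z @^-1` A) <= (2^-1)%:E)%E.
  rewrite Pn; last exact: measurable_itv.
  apply: (@le_trans _ _ (2 * (`|s| / 2) * (2^-1 * `|s|^-1))%:E%E).
    apply: (normal_prob_le (a := 0)) => //.
    - exact: measurable_itv.
    - by rewrite sub0r add0r.
    - by move=> x _; have := normal_pdf_tail s0 (lexx 0) (normr_ge0 x);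
        rewrite expr0n/= mul0r oppr0 expR0 mulr1.
  by rewrite lee_fin le_eqVlt; apply/orP; left; apply/eqP; field; rewrite normr_eq0.
have mZA : measurable (Z @^-1` A) by rewrite -[X in measurable X]setTI; apply: mZ => //; exact: measurable_itv.
have PnA : ((2^-1)%:E <= P (~` (Z @^-1` A)))%E.
  rewrite probability_setC// leeBrDr ?fin_num_measure//.
  apply: (le_trans (leeD2l _ PA)); rewrite -EFinD lee_fin; lra.
have : ((s ^+ 2 / 8)%:E <= \int[P]_w (Z w ^+ 2)%:E)%E.
  apply: (@le_trans _ _ ((s ^+ 2 / 4)%:E * P (~` (Z @^-1` A)))%E).
    apply: le_trans (lee_wpmul2l _ PnA); last by rewrite lee_fin divr_ge0// sqr_ge0.
    by rewrite -EFinM lee_fin; lra.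
  rewrite -integral_cst//; last exact: measurableC.
  apply: (@le_trans _ _ (\int[P]_(w in ~` (Z @^-1` A)) (Z w ^+ 2)%:E)%E).
    have mZ2 : measurable_fun setT (fun w => (Z w ^+ 2)%:E).
      by apply/measurable_EFinP; exact: measurable_funX.
    apply: ge0_le_integral => //; first exact: measurableC.
    + by move=> w _; rewrite lee_fin divr_ge0// sqr_ge0.
    + exact: measurable_funTS.
    + move=> w /=; rewrite /A /= in_itv/= -ler_norml => /negP; rewrite -ltNge => h.
      rewrite lee_fin -[leRHS]real_normK ?num_real// -[X in X / 4]real_normK ?num_real//.
      have -> : `|s| ^+ 2 / 4 = (`|s| / 2) ^+ 2 by field.
      by rewrite lerXn2r ?nnegrE ?divr_ge0// ltW.
  apply: ge0_subset_integral => //; first exact: measurableC.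
    by apply/measurable_EFinP; exact: measurable_funX.
  by move=> w _; rewrite lee_fin sqr_ge0.
rewrite centred_gaussian_moment lee_fin => h.
rewrite -ler_sqr ?nnegrE ?mulr_ge0 ?(ltW sg0)// exprMn real_normK ?num_real//.
by move: h; rewrite ler_pdivrMr//; nra.
Qed.

(** The density bound on the tail times the length [2 r] of the interval; the constants 3 and 18
    arise on replacing [s] by [sg]. *)
Lemma centred_gaussian_tail_ball (a r t : R) : 0 <= r -> 0 <= t ->
  (P (Z @^-1` ([set x : R | (`|x - a| <= r)%R] `&` [set x : R | (t <= `|x|)%R])) <=
    (3 * r / sg * expR (- (t ^+ 2 / (18 * sg ^+ 2))))%:E)%E.
Proof.
move=> r0 t0; have [s [s0 sgs ssg Pn]] := centred_gaussian_scale.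
have s20 : 0 < s ^+ 2 by rewrite exprn_even_gt0.
have sn0 : 0 < `|s| by rewrite normr_gt0.
have E1 : [set x : R | `|x - a| <= r] = `[a - r, a + r]%classic.
  by apply/seteqP; split => x; rewrite /= in_itv/= ler_distl.
have mA : measurable ([set x | `|x - a| <= r] `&` [set x : R | (t <= `|x|)%R]).
  apply: measurableI; first by rewrite E1.
  rewrite -[X in measurable X]setTI.
  by apply: measurable_fun_le => //; exact: measurable_cst.
rewrite Pn//.
apply: (le_trans (normal_prob_le (a := a) (r := r)
    (M := 2^-1 * `|s|^-1 * expR (- (t ^+ 2 / (2 * s ^+ 2)))) s0 mA _ r0 _ _)).
- by move=> x []; rewrite E1.
- by rewrite !mulr_ge0 ?expR_ge0.
- by move=> x [_ tx]; exact: normal_pdf_tail.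
rewrite lee_fin; have -> : 2 * r * (2^-1 * `|s|^-1 * expR (- (t ^+ 2 / (2 * s ^+ 2)))) =
  r / `|s| * expR (- (t ^+ 2 / (2 * s ^+ 2))) by field; rewrite gt_eqF.
apply: ler_pM; rewrite ?expR_ge0 ?divr_ge0//.
  rewrite ler_pdivrMr// (_ : 3 * r / sg * `|s| = r * (3 * `|s| / sg)); last by ring.
  by rewrite ler_peMr// ler_pdivlMr// mul1r.
rewrite ler_expR lerN2 ler_wpM2l ?sqr_ge0// lef_pV2 ?posrE;
  [|by rewrite mulr_gt0// exprn_gt0|by rewrite mulr_gt0].
rewrite (_ : 18 * sg ^+ 2 = 2 * (3 * sg) ^+ 2); last by ring.
by rewrite ler_pM2l// -[leLHS]real_normK ?num_real// lerXn2r ?nnegrE ?mulr_ge0 ?(ltW sg0).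
Qed.

End GaussianIncrement.

Section ProbabilityBounds.
Context {R : realType} {dT : measure_display} {T : measurableType dT}.
Variable P : probability T R.

Lemma probability_bigsetU_le (I : Type) (r : seq I) (A : I -> set T) :
  (forall i, measurable (A i)) ->
  (P (\big[setU/set0]_(i <- r) A i) <= \sum_(i <- r) P (A i))%E.
Proof.
move=> mA; elim: r => [|i r IH]; first by rewrite !big_nil measure0.
have mr : measurable (\big[setU/set0]_(j <- r) A j) by exact: bigsetU_measurable.
rewrite !big_cons; apply: (le_trans (measureU2 P (mA i) mr)).
by rewrite leeD2l.
Qed.

Lemma prod_probability_le (k : nat) (A : 'I_k -> set T) (b : 'I_k -> R) :
  (forall i, measurable (A i)) -> (forall i, (P (A i) <= (b i)%:E)%E) ->
  (\prod_(i < k) P (A i) <= (\prod_(i < k) b i)%:E)%E.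
Proof.
move=> mA Ab.
have -> : (\prod_(i < k) P (A i) = (\prod_(i < k) fine (P (A i)))%:E)%E.
  by rewrite -prodEFin; apply: eq_bigr => i _; rewrite fineK// fin_num_measure.
rewrite lee_fin; apply: ler_prod => i _; rewrite fine_ge0//=.
by rewrite -lee_fin fineK// fin_num_measure.
Qed.

(** Chebyshev's inequality, meant for increments of variance zero, where no density is available. *)
Lemma zero_moment_tail (Z : T -> R) (t : R) : measurable_fun setT Z -> 0 < t ->
  ('E_P[fun w => (`|Z w| ^+ 2)%R] = 0)%E -> P [set w | t <= `|Z w|] = 0%E.
Proof.
move=> mZ t0 EZ; apply/le_anti/andP; split => //.
have t20 : 0 < t ^+ 2 by rewrite exprn_gt0.
have mZ2 : measurable_fun setT (fun w => (`|Z w| ^+ 2)%:E).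
  apply/measurable_EFinP; apply: measurable_funX; exact: measurableT_comp.
have := le_integral_abse P measurableT mZ2 t20.
rewrite [X in (_ <= X)%E](_ : _ = 0%E); last first.
  rewrite -EZ expectation.unlock; apply: eq_integral => w _.
  by rewrite gee0_abs// lee_fin exprn_ge0.
rewrite pmule_rle0 ?lte_fin//; apply: le_trans.
apply: le_measure.
- apply/mem_set; rewrite -[X in measurable X]setTI; apply: measurable_fun_le => //.
  exact: measurableT_comp.
- apply/mem_set; apply: emeasurable_fun_c_infty => //; exact: measurableT_comp.
- move=> w /= tw; split => //; rewrite lee_fin ger0_norm ?exprn_ge0//.
  by rewrite lerXn2r ?nnegrE// ltW.
Qed.

End ProbabilityBounds.

Lemma expRN_le_pow {R : realType} (u : R) (k : nat) : 0 < u ->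
  expR (- u) <= (k%:R / u) ^+ k.
Proof.
move=> u0; case: k => [|k].
  by rewrite expr0 -[leRHS]expR0 ler_expR oppr_le0 ltW.
have k0 : 0 < k.+1%:R :> R by [].
rewrite -[k.+1%:R / u]invrK invf_div exprVn expRN lef_pV2 ?posrE ?expR_gt0 ?exprn_gt0 ?divr_gt0//.
have -> : expR u = expR (u / k.+1%:R) ^+ k.+1.
  by rewrite -expRM_natl; congr expR; field; rewrite gt_eqF.
rewrite lerXn2r ?nnegrE ?expR_ge0 ?divr_ge0 ?(ltW u0)//.
by apply: le_trans (expR_ge1Dx _); rewrite lerDr.
Qed.

Section SmallBall.
Context {R : realType} {k d n : nat}.
Variable phi : {linear 'rV[R]_k -> 'rV[R]_d}.
Hypothesis phi_iso : forall u, enorm (phi u) = enorm u.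
Variable alpha : R.
Hypothesis alpha0 : 0 < alpha.
Context {dT : measure_display} {T : measurableType dT}.
Variable P : probability T R.
Variable W : 'rV[R]_n -> T -> 'rV[R]_k.
Hypothesis hW : fractional_brownian_motion P alpha W.
Hypothesis k0 : (0 < k)%N.

Let inc y y' i w := coord_process W i y w - coord_process W i y' w.
Let sg (y y' : 'rV[R]_n) := enorm (y - y') `^ alpha.

Lemma increment_gaussian y y' i : centred_gaussian P (inc y y' i).
Proof.
have [gW _ _ _ _] := hW.
have := gW 2 (fun j => (if j == ord0 then y else y', i)) (fun j => if j == ord0 then 1 else -1).
rewrite (_ : (fun w => _) = inc y y' i)//; apply/funext => w.
by rewrite !big_ord_recl big_ord0 /= mul1r mulN1r addr0.
Qed.

Lemma increment_moment y y' i :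
  ('E_P[fun w => (`|inc y y' i w| ^+ 2)%R] = (sg y y' ^+ 2)%:E)%E.
Proof.
have [_ _ _ _ mW] := hW; rewrite (mW i).2; congr EFin.
by rewrite /sg -powR_mulrn ?powR_ge0// -powRrM mulrC.
Qed.

(** Each event lies in the sigma-algebra generated by one coordinate process. *)
Lemma increment_independent y y' (A : 'I_k -> set R) :
  (forall i, measurable (A i)) ->
  P (\bigcap_(i in [set: 'I_k]) (inc y y' i @^-1` A i)) =
  (\prod_(i < k) P (inc y y' i @^-1` A i))%E.
Proof.
move=> mA; have [_ _ iW _ _] := hW; apply: iW => i.
pose G := \bigcup_(t in [set: 'rV[R]_n])
  [set coord_process W i t @^-1` A | A in [set A : set R | measurable A]].
have mc t : measurable_fun (setT : set (g_sigma_algebraType G)) (coord_process W i t).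
  move=> _ B mB; rewrite setTI; apply: sub_sigma_algebra; exists t => //.
  by exists B.
have mD : measurable_fun (setT : set (g_sigma_algebraType G)) (inc y y' i).
  exact: measurable_funB.
by have := mD measurableT _ (mA i); rewrite setTI.
Qed.

Lemma increment_box y y' (a t : 'I_k -> R) (r : R) : 0 < sg y y' -> 0 <= r ->
  (forall i, 0 <= t i) -> exists B, [/\ measurable B,
    forall w, (forall i, `|inc y y' i w - a i| <= r /\ t i <= `|inc y y' i w|) -> B w &
    (P B <= (\prod_(i < k) (3 * r / sg y y' *
               expR (- (t i ^+ 2 / (18 * sg y y' ^+ 2)))))%:E)%E].
Proof.
move=> s0 r0 t0.
pose A i := [set x : R | `|x - a i| <= r] `&` [set x : R | t i <= `|x|].
have mA i : measurable (A i).
  rewrite /A -[X in X `&` _]setTI -[X in _ `&` X]setTI; apply: measurableI.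
    apply: measurable_fun_le => //; apply: measurableT_comp => //.
    exact: measurable_funB.
  by apply: measurable_fun_le => //; exact: measurableT_comp.
have mi i : measurable_fun setT (inc y y' i) by case: (increment_gaussian y y' i).
have mAi i : measurable (inc y y' i @^-1` A i).
  by rewrite -[X in measurable X]setTI; apply: mi.
exists (\bigcap_(i in [set: 'I_k]) (inc y y' i @^-1` A i)); split.
- by apply: fin_bigcap_measurable => // i _.
- by move=> w Hw i _; have [] := Hw i.
rewrite increment_independent//; apply: prod_probability_le => // i.
apply: centred_gaussian_tail_ball => //; first exact: increment_gaussian.
exact: increment_moment.
Qed.

(* The event is enclosed in a measurable union of boxes in the coordinates of the
   increment, which are independent. *)
Lemma increment_small_ball : exists2 C : R, 0 < C &
  forall z y y' r, 0 < r -> exists B, [/\ measurable B,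
    forall w, `|z + phi (W y w - W y' w)| <= r -> B w &
    (P B <= (C * (r / Num.max (Num.max `|z| (`|y - y'| `^ alpha)) r) ^+ k)%:E)%E].
Proof.
(* [C1] serves [r] comparable to [M], [C2] the case where [sg y y'] dominates [|z|], and [C3] the
   case where [|z|] dominates. *)
pose C1 : R := 2 ^+ k; pose C2 : R := (6 * d%:R) ^+ k.
pose C3 : R := k%:R * ((12 * k%:R) ^+ 3 * d%:R) ^+ k.
have C10 : 0 < C1 by rewrite exprn_gt0.
have C20 : 0 <= C2 by rewrite exprn_ge0// mulr_ge0.
have C30 : 0 <= C3 by rewrite mulr_ge0// exprn_ge0// !mulr_ge0// exprn_ge0.
exists (C1 + C2 + C3) => [|z y y' r r0]; first by rewrite -addrA ltr_pwDl// addr_ge0.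
set M := Num.max _ r.
have rM : r <= M by rewrite le_max lexx orbT.
have M0 : 0 < M by exact: lt_le_trans rM.
have q0 : 0 <= (r / M) ^+ k by rewrite exprn_ge0// divr_ge0// ltW.
have [Mr|rM2] := leP M (2 * r).
  exists setT; split => //; rewrite probability_setT lee_fin.
  apply: (@le_trans _ _ (C1 * (r / M) ^+ k)); last first.
    by rewrite ler_wpM2r// -addrA lerDl addr_ge0.
  rewrite /C1 -exprMn exprn_ege1// mulrA ler_pdivlMr// mul1r.
  by [].
(* The boxes are centred at the increment of one outcome [w0] of the event, since [- z] need not lie
   in the range of [phi]. *)
have [[w0 Hw0]|H] := pselect (exists w, `|z + phi (W y w - W y' w)| <= r); last first.
  exists set0; split => //; first by move=> w Hw; apply: H; exists w.
  by rewrite measure0 lee_fin mulr_ge0// !addr_ge0// ltW.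
(* Two outcomes of the event differ by at most [2 r] after [phi]; the factor [d] passes from the sup
   norm to the Euclidean one. *)
pose rho := 2 * d%:R * r.
have rho0 : 0 <= rho by rewrite !mulr_ge0// ltW.
pose g i := inc y y' i w0.
have near w i : `|z + phi (W y w - W y' w)| <= r -> `|inc y y' i w - g i| <= rho.
  move=> Hw.
  have -> : inc y y' i w - g i = ((W y w - W y' w) - (W y w0 - W y' w0)) 0 i.
    by rewrite !mxE.
  apply: le_trans (coord_le_norm _ i) _; apply: le_trans (norm_le_enorm _) _.
  rewrite -phi_iso; apply: le_trans (enorm_le_norm _) _.
  rewrite /rho -mulrA mulrCA ler_wpM2l//.
  have -> : phi (W y w - W y' w - (W y w0 - W y' w0)) =
    (z + phi (W y w - W y' w)) - (z + phi (W y w0 - W y' w0)).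
    by rewrite linearB/= opprD addrACA subrr add0r.
  by apply: le_trans (ler_normB _ _) _; rewrite mulr_natl mulr2n lerD.
have sge : `|y - y'| `^ alpha <= sg y y'.
  apply: ge0_ler_powR; rewrite ?nnegrE ?sqrtr_ge0 ?(ltW alpha0)//.
  exact: norm_le_enorm.
have [zs|sz] := leP `|z| (sg y y').
  have Ms : M <= sg y y'.
    have : M <= Num.max (sg y y') r.
      by rewrite /M ge_max !le_max lexx orbT andbT ge_max zs sge.
    by case: (leP r (sg y y')) => // _ Mr; move: (lt_le_trans rM2 Mr); lra.
  have s0 : 0 < sg y y' by exact: lt_le_trans Ms.
  have [B [mB HB PB]] := increment_box g (t := fun=> 0) s0 rho0 (fun=> lexx 0).
  exists B; split => //.
    by move=> w Hw; apply: HB => i; split => //; exact: near.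
  apply: (le_trans PB); rewrite lee_fin.
  under eq_bigr do rewrite expr0n/= mul0r oppr0 expR0 mulr1.
  rewrite prodr_const card_ord; apply: (@le_trans _ _ (C2 * (r / M) ^+ k)); last first.
    by rewrite ler_wpM2r// addrAC lerDr addr_ge0// ltW.
  rewrite /C2 -exprMn lerXn2r ?nnegrE ?divr_ge0 ?mulr_ge0 ?invr_ge0 ?(ltW r0) ?(ltW s0) ?(ltW M0)//.
  rewrite /rho (_ : 3 * (2 * d%:R * r) / sg y y' = 6 * d%:R * (r / sg y y')); last by ring.
  by rewrite !ler_wpM2l// ?mulr_ge0// ?(ltW r0)// lef_pV2 ?posrE.
have Mz : M = `|z|.
  move: rM2; rewrite /M (max_l (ltW (le_lt_trans sge sz))).
  by case: (leP r `|z|) => // _; lra.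
(* Were all coordinates of the increment below [t], its image would have norm at most [|z| / 4], too
   short to bring [z] within [r < |z| / 2] of 0. *)
pose t := `|z| / (4 * k%:R).
have z0 : 0 < `|z| by rewrite -Mz.
have t0 : 0 < t by rewrite divr_gt0// mulr_gt0// ltr0n.
have far w : `|z + phi (W y w - W y' w)| <= r -> exists i, t <= `|inc y y' i w|.
  move=> Hw; apply: contrapT => H.
  have : `|W y w - W y' w| <= t.
    apply: norm_le_coord => [|i]; first exact: ltW.
    rewrite leNgt; apply/negP => ti; apply: H; exists i; apply: ltW.
    by move: ti; rewrite !mxE.
  move=> Gt; have phiG : `|phi (W y w - W y' w)| <= `|z| / 4.
    apply: le_trans (norm_le_enorm _) _; rewrite phi_iso.
    apply: le_trans (enorm_le_norm _) _; apply: (le_trans (ler_wpM2l _ Gt)) => //.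
    rewrite /t (_ : k%:R * (`|z| / (4 * k%:R)) = `|z| / 4)//.
    by field; rewrite pnatr_eq0 -lt0n.
  have := ler_normB (z + phi (W y w - W y' w)) (phi (W y w - W y' w)).
  rewrite addrK; move: rM2; rewrite Mz; lra.
have mi i : measurable_fun setT (inc y y' i) by case: (increment_gaussian y y' i).
have [s0|s0] := eqVneq (sg y y') 0.
  pose B i := [set w | t <= `|inc y y' i w|].
  have mB i : measurable (B i).
    rewrite /B -[X in measurable X]setTI; apply: measurable_fun_le => //.
    exact: measurableT_comp.
  exists (\big[setU/set0]_(i <- enum 'I_k) B i); split.
  - exact: bigsetU_measurable.
  - move=> w /far[i ti]; rewrite -bigcup_seq; exists i => //.
    by rewrite /= mem_enum.
  apply: (le_trans (probability_bigsetU_le P _ mB)).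
  rewrite big1 => [|i _]; first by rewrite lee_fin mulr_ge0// !addr_ge0// ltW.
  apply: zero_moment_tail => //.
  by rewrite increment_moment s0 expr0n.
have {}s0 : 0 < sg y y' by rewrite lt_def s0 powR_ge0.
(* One box for each coordinate [i0] that may be the large one; the others keep the threshold 0. *)
have /choice[B HB] : forall i0 : 'I_k, exists B, [/\ measurable B,
    forall w, (forall i, `|inc y y' i w - g i| <= rho /\
       (if i == i0 then t else 0) <= `|inc y y' i w|) -> B w &
    (P B <= (\prod_(i < k) (3 * rho / sg y y' *
      expR (- ((if i == i0 then t else 0) ^+ 2 / (18 * sg y y' ^+ 2)))))%:E)%E].
  move=> i0; apply: increment_box => // i; case: ifP => // _; exact: ltW.
exists (\big[setU/set0]_(i <- enum 'I_k) B i); split.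
- by apply: bigsetU_measurable => i _; have [] := HB i.
- move=> w Hw; have [i0 ti0] := far w Hw.
  rewrite -bigcup_seq; exists i0; first by rewrite /= mem_enum.
  have [_ H _] := HB i0; apply: H => i; split; first exact: near.
  by case: eqP => // ->.
have mB i : measurable (B i) by have [] := HB i.
apply: (le_trans (probability_bigsetU_le P _ mB)).
apply: (@le_trans _ _ (\sum_(i <- enum 'I_k)
   (((12 * k%:R) ^+ 3 * d%:R) ^+ k * (r / M) ^+ k)%:E)%E).
  apply: lee_sum => i0 _; have [_ _ Pi0] := HB i0.
  apply: (le_trans Pi0); rewrite lee_fin big_split/= prodr_const card_ord.
  rewrite (bigD1 i0)//= eqxx big1 ?mulr1 => [|i /negbTE ->]; last first.
    by rewrite expr0n/= mul0r oppr0 expR0.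
  have u0 : 0 < t ^+ 2 / (18 * sg y y' ^+ 2) by apply: divr_gt0; [exact: exprn_gt0|rewrite mulr_gt0// exprn_gt0].
  (* Traded for a power [k], the exponential yields [(sg / |z|) ^ 2] in each factor; this absorbs
     [1 / sg] because [sg < |z|], leaving [r / |z|]. *)
  apply: (le_trans (ler_wpM2l _ (expRN_le_pow k u0))).
    by rewrite exprn_ge0// divr_ge0 ?mulr_ge0// ltW.
  rewrite -!exprMn; apply: lerXn2r; rewrite ?nnegrE.
  - apply: mulr_ge0; first by apply: divr_ge0; [exact: mulr_ge0|exact: ltW].
    by apply: divr_ge0 => //; exact: ltW.
  - apply: mulr_ge0; last by apply: divr_ge0; exact: ltW.
    by apply: mulr_ge0 => //; apply: exprn_ge0; rewrite mulr_ge0.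
  rewrite Mz /t /rho.
  have -> : 3 * (2 * d%:R * r) / sg y y' *
    (k%:R / ((`|z| / (4 * k%:R)) ^+ 2 / (18 * sg y y' ^+ 2))) =
    (12 * k%:R) ^+ 3 * d%:R * (r / `|z|) * (sg y y' / `|z|).
    by field; rewrite gt_eqF//= gt_eqF//= pnatr_eq0 -lt0n.
  rewrite ler_piMr// ?ler_pdivrMr ?mul1r ?(ltW sz)//.
  by rewrite !mulr_ge0 ?invr_ge0 ?exprn_ge0 ?(ltW r0)// ltW.
rewrite sumEFin lee_fin big_const_seq count_predT -cardE card_ord iter_addr_0.
apply: (@le_trans _ _ (C3 * (r / M) ^+ k)); first by rewrite /C3 -mulrA [leRHS]mulr_natl.
by rewrite ler_wpM2r// lerDr addr_ge0// ltW.
Qed.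

End SmallBall.

(** * Energies and Hausdorff measure of the image *)

Section EnergyLowerBound.
Context {R : realType} {m : nat}.
Implicit Types (S A : set 'rV[R]_m).

(** A step version of the kernel of order [t], truncated at scale [2 ^- N]; being a sum of
    indicators of [z <= 2 ^- j], it reduces expectations to small ball probabilities. *)
Definition dyadic_kernel (t : R) (N : nat) (z : R) : R :=
  \sum_(j < N) (if z <= 2 ^- j then (2 `^ t) ^+ j else 0).

Definition bounded_energy S (t E : R) (N : nat) : Prop :=
  exists (I : finType) (u : I -> 'rV[R]_m) (p : I -> R),
  [/\ forall a, S (u a), forall a, 0 <= p a, \sum_a p a = 1 &
     \sum_a \sum_b p a * p b * dyadic_kernel t N `|u a - u b| <= E].

(** Cauchy-Schwarz for the masses [mm i] that the assignment [f] gives to the pieces: pairs inside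
    piece [i] contribute [mm i ^+ 2 * h i] to the energy. *)
Lemma weighted_cover_le (I : finType) (p : I -> R) (J : seq nat) (f : I -> nat)
    (h : nat -> R) (E : R) :
  uniq J -> (forall a, f a \in J) -> \sum_a p a = 1 -> (forall i, 0 < h i) -> 0 < E ->
  \sum_a \sum_b p a * p b * (if f a == f b then h (f a) else 0) <= E ->
  1 <= E * \sum_(i <- J) (h i)^-1.
Proof.
move=> uJ fJ p1 h0 E0 pE.
pose mm i := \sum_(a | f a == i) p a.
have mm1 : \sum_(i <- J) mm i = 1.
  rewrite -p1 /mm; under eq_bigr do rewrite big_mkcond/=.
  rewrite exchange_big/=; apply: eq_bigr => a _.
  rewrite (bigD1_seq (f a))//= eqxx big1 ?addr0// => i.
  by rewrite eq_sym => /negbTE ->.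
have mm2 : \sum_(i <- J) mm i ^+ 2 * h i =
    \sum_a \sum_b p a * p b * (if f a == f b then h (f a) else 0).
  transitivity (\sum_(i <- J) \sum_a \sum_b
      (if (f a == i) && (f b == i) then p a * p b * h i else 0)).
    apply: eq_bigr => i _; rewrite expr2 {1}/mm big_mkcond -mulrA mulr_suml.
    apply: eq_bigr => a _; case: eqP => [_|_]; last first.
      by rewrite mul0r big1// => c _; case: ifP.
    rewrite /mm big_mkcond/= mulr_suml mulr_sumr; apply: eq_bigr => c _ /=.
    by case: eqP => _; rewrite ?mul0r ?mulr0// mulrA.
  rewrite exchange_big/=; apply: eq_bigr => a _.
  rewrite exchange_big/=; apply: eq_bigr => c _.
  rewrite (bigD1_seq (f a))//= eqxx /= big1 ?addr0 => [|i].
    by rewrite [in RHS]eq_sym; case: eqP => _; rewrite ?mulr0.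
  by rewrite eq_sym => /negbTE ->.
(* AM-GM: [2 m <= E / h + m ^ 2 * h / E] *)
have : 2 * \sum_(i <- J) mm i <=
    E * \sum_(i <- J) (h i)^-1 + E^-1 * \sum_(i <- J) mm i ^+ 2 * h i.
  rewrite !mulr_sumr -big_split/=; apply: ler_sum => i _.
  have hi := h0 i; rewrite -subr_ge0.
  have -> : E / h i + E^-1 * (mm i ^+ 2 * h i) - 2 * mm i =
    (E * h i)^-1 * (E - mm i * h i) ^+ 2.
    by field; rewrite !gt_eqF.
  by rewrite mulr_ge0 ?sqr_ge0// invr_ge0 mulr_ge0 ?ltW.
rewrite mm1 mulr1 mm2 => le2.
have : E^-1 * (\sum_a \sum_b p a * p b * (if f a == f b then h (f a) else 0)) <= 1.
  by rewrite mulrC ler_pdivrMr// mul1r.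
lra.
Qed.

(** Compactness needs open covers, so a piece is enlarged at the price [e] in gauge. The bound [r]
    is positive even for diameter 0, and at most one half so that it has a dyadic scale. *)
Lemma open_thickening (U : set 'rV[R]_m) (s e : R) : 0 < s -> 0 < e ->
  (diam U <= (4^-1)%:E)%E ->
  exists (V : set 'rV[R]_m) (r : R), [/\ open V, U `<=` V, 0 < r <= 2^-1,
    forall y y', V y -> V y' -> `|y - y'| <= r &
    ((r `^ s)%:E <= hausdorff_gauge s U + e%:E)%E \/ V = set0].
Proof.
move=> s0 e0 dU; have [->|U0] := eqVneq U set0.
  exists set0, 2^-1; split => //.
  - by rewrite lexx invr_gt0 ltr0n.
  by right.
have dU0 : (0 <= diam U)%E by apply: diam_ge0; apply/set0P.
have dUfin : diam U \is a fin_num.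
  by rewrite ge0_fin_numE// (le_lt_trans dU)// ltry.
pose dd := fine (diam U); have dd0 : 0 <= dd by exact: fine_ge0.
have ddU : diam U = dd%:E by rewrite fineK.
have dd4 : dd <= 4^-1 by rewrite -lee_fin -ddU.
pose r0 := (dd `^ s + e) `^ s^-1.
have dse0 : 0 < dd `^ s + e by rewrite ltr_wpDl// powR_ge0.
have r0s : r0 `^ s = dd `^ s + e.
  by rewrite -powRrM mulVf ?gt_eqF// powRr1// ltW.
have r0d : dd < r0.
  rewrite ltNge; apply/negP => h.
  have : r0 `^ s <= dd `^ s.
    by apply: ge0_ler_powR; rewrite ?nnegrE ?powR_ge0 ?(ltW s0).
  by rewrite r0s; lra.
pose r := Num.min r0 2^-1.
have rd : dd < r by rewrite lt_min r0d; lra.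
pose eta := (r - dd) / 2.
have eta0 : 0 < eta by rewrite divr_gt0// subr_gt0.
exists (\bigcup_(u in U) ball u eta), r; split.
- by apply: bigcup_open => u _; exact: ball_open.
- by move=> u Uu; exists u => //; exact: ballxx.
- by rewrite (le_lt_trans dd0 rd) ge_min lexx orbT.
- move=> y y' [u Uu]; rewrite -ball_normE /= => uy [u' Uu'] u'y'.
  have : `|u - u'| <= dd.
    rewrite (le_trans (norm_le_enorm _))// -lee_fin -ddU.
    by apply: ereal_sup_ubound; exists u => //; exists u'.
  have -> : y - y' = (u - u') - (u - y) + (u' - y').
    by apply/rowP => i; rewrite !mxE; ring.
  have := ler_normD ((u - u') - (u - y)) (u' - y').
  have := ler_normB (u - u') (u - y).
  by move: uy u'y'; rewrite /ball_ /= /eta; lra.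
left; rewrite /hausdorff_gauge (negbTE U0) ddU poweR_EFin -EFinD lee_fin -r0s.
apply: ge0_ler_powR; rewrite ?nnegrE ?powR_ge0 ?(ltW s0)//.
  exact: ltW (le_lt_trans dd0 rd).
by rewrite ge_min lexx.
Qed.

Lemma dyadic_scale (r : R) : 0 < r <= 1 -> exists j : nat, r <= 2 ^- j /\ 2 ^- j.+1 < r.
Proof.
move=> /andP[r0 r1]; have [N Nr] := expN2_le r0.
have : exists n, 2 ^- n.+1 < r.
  exists N; apply: lt_le_trans Nr; rewrite ltf_pV2 ?posrE ?exprn_gt0//.
  by rewrite ltr_eXn2l ?ltr1n.
move=> /ex_minnP[j jr jmin]; exists j; split => //.
case: j jr jmin => [|j] jr jmin; first by rewrite expr0 invr1.
by rewrite leNgt; apply/negP => /jmin; rewrite ltnn.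
Qed.

(** A cover of cost below [e] is thickened and made finite, and [N] is taken beyond all its scales.
    Two atoms in a piece of scale [j] then contribute at least the [j]-th kernel term, and
    [weighted_cover_le] contradicts the small cost. *)
Lemma hausdorff_measure_neq0 S A (t s E : R) : compact S -> S `<=` A -> S !=set0 ->
  0 <= s <= t -> 0 < E ->
  (forall N0, exists2 N, (N0 <= N)%N & bounded_energy S t E N) ->
  hausdorff_measure s A <> 0%E.
Proof.
move=> cS SA S0 /andP[s0 st] E0 HE H0.
have pre0 dl : 0 < dl -> (hausdorff_premeasure s dl A <= 0)%E.
  by move=> dl0; rewrite -H0; apply: ereal_sup_ubound; exists dl.
have d40 : 0 < 4^-1 :> R by rewrite invr_gt0.
move: s0; rewrite le_eqVlt => /orP[/eqP s0|s0].
  have : (hausdorff_premeasure s 4^-1 A < 1)%E.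
    by apply: le_lt_trans (pre0 _ d40) _; rewrite lte_fin.
  move=> /ereal_inf_lt[_ [U [AU _] <-]]; apply/negP; rewrite -leNgt.
  have [x Sx] := S0; have [i _ Uix] := AU _ (SA _ Sx).
  have U1 : hausdorff_gauge s (U i) = 1%E.
    rewrite /hausdorff_gauge -s0 poweRe0; case: eqP => // U0.
    by move: Uix; rewrite U0.
  rewrite -U1; have := @lee_sum_fset_lim _ (fun i => hausdorff_gauge s (U i)) [fset i]%fset
    xpredT (fun i _ => hausdorff_gauge_ge0 s (U i)).
  by rewrite big_seq_fset1.
pose lam := 2 `^ t * E.
have lam0 : 0 < lam by rewrite mulr_gt0// powR_gt0.
(* Makes the final bound [lam * (e + e)] one half: one [e] for the cover, one for the
   thickenings. *)
pose e := (4 * lam)^-1.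
have e0 : 0 < e by rewrite invr_gt0 mulr_gt0.
have : (hausdorff_premeasure s 4^-1 A < e%:E)%E.
  by apply: le_lt_trans (pre0 _ d40) _; rewrite lte_fin.
move=> /ereal_inf_lt[_ [U [AU dU] <-] Ue].
pose ee (i : nat) := e / (2 ^ i.+1)%N%:R.
have ee0 i : 0 < ee i by rewrite divr_gt0// ltr0n expn_gt0.
have /choice[V HV] i := open_thickening s0 (ee0 i) (dU i).
have /choice[r Hr] := HV.
have [J _ SJ] : finite_subset_cover [set: nat] V S.
  move: (cS); rewrite compact_cover; apply => [i _|x Sx]; first by have [] := Hr i.
  by have [i _ Uix] := AU _ (SA _ Sx); exists i => //; have [_ UV _ _ _] := Hr i; exact: UV.
have /choice[jj Hjj] : forall i, exists j : nat, r i <= 2 ^- j /\ 2 ^- j.+1 < r i.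
  move=> i; apply: dyadic_scale; have [_ _ /andP[r0 r1] _ _] := Hr i.
  by rewrite r0 (le_trans r1)// invf_le1// ler1n.
have [N NJ [I [u [p [uS p0 p1 pE]]]]] := HE (\max_(i <- J) (jj i).+1)%N.
have /choice[f Hf] : forall a, exists i, i \in J /\ V i (u a).
  by move=> a; have [i iJ Vi] := SJ _ (uS a); exists i.
(* Empty pieces are dropped, as their [r i] is not controlled by the gauge. *)
have le1 : 1 <= E * \sum_(i <- [seq i <- J | V i != set0]) ((2 `^ t) ^+ jj i)^-1.
  apply: (weighted_cover_le (p := p) (f := f)) => //.
  - by rewrite filter_uniq// fset_uniq.
  - move=> a; rewrite mem_filter; have [-> Vi] := Hf a; rewrite andbT.
    by apply/set0P; exists (u a).
  apply: le_trans pE; apply: ler_sum => a _; apply: ler_sum => b _.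
  apply: ler_wpM2l; first exact: mulr_ge0.
  have kge0 : 0 <= dyadic_kernel t N `|u a - u b|.
    by apply: sumr_ge0 => j _; case: ifP => // _; rewrite exprn_ge0// powR_ge0.
  case: eqP => // fab.
  have jN : (jj (f a) < N)%N.
    apply: leq_trans NJ; have [faJ _] := Hf a.
    exact: (leq_bigmax_seq (F := fun i => (jj i).+1) (f a) faJ).
  rewrite /dyadic_kernel (bigD1 (Ordinal jN))//= ifT.
    by rewrite lerDl sumr_ge0// => j _; case: ifP => // _; rewrite exprn_ge0// powR_ge0.
  have [_ _ _ Hd _] := Hr (f a); apply: le_trans (Hjj (f a)).1.
  by apply: Hd; [have [] := Hf a|rewrite fab; have [] := Hf b].
have sum_le : \sum_(i <- [seq i <- J | V i != set0]) ((2 `^ t) ^+ jj i)^-1 <=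
    2 `^ t * \sum_(i <- [seq i <- J | V i != set0]) r i `^ s.
  rewrite mulr_sumr; apply: ler_sum => i _.
  have [_ _ /andP[ri0 ri1] _ _] := Hr i.
  have -> : ((2 `^ t) ^+ jj i)^-1 = 2 `^ t * (2 ^- (jj i).+1) `^ t.
    have q0 : 2 `^ t != 0 :> R by rewrite gt_eqF// powR_gt0.
    by rewrite -powR_geometric powRN exprS exprVn mulrA divff// mul1r.
  rewrite ler_wpM2l ?powR_ge0//.
  apply: (@le_trans _ _ (r i `^ t)).
    apply: ge0_ler_powR; rewrite ?nnegrE ?invr_ge0 ?exprn_ge0//.
    - exact: le_trans (ltW s0) st.
    - exact: ltW.
    - exact: ltW (Hjj i).2.
  apply: ger_powR => //; rewrite ri0/= (le_trans ri1)//.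
  by rewrite invf_le1// ler1n.
have : ((\sum_(i <- [seq i <- J | V i != set0]) r i `^ s)%:E <= e%:E + e%:E)%E.
  rewrite -sumEFin.
  apply: (@le_trans _ _ (\sum_(i <- [seq i <- J | V i != set0])
      (hausdorff_gauge s (U i) + (ee i)%:E))%E).
    rewrite big_seq [leRHS]big_seq; apply: lee_sum => i.
    rewrite mem_filter => /andP[Vi _].
    by have [_ _ _ _ [//|V0]] := Hr i; rewrite V0 eqxx in Vi.
  have ge0 i : (0 <= hausdorff_gauge s (U i))%E := hausdorff_gauge_ge0 s (U i).
  rewrite big_filter.
  have gee0 i : V i != set0 -> (0 <= hausdorff_gauge s (U i) + (ee i)%:E)%E.
    by move=> _; rewrite adde_ge0// lee_fin ltW.
  apply: (le_trans (@lee_sum_fset_lim _ (fun i => hausdorff_gauge s (U i) + (ee i)%:E)%E J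
    (fun i => V i != set0) gee0)).
  apply: (le_trans (epsilon_trick _ ge0 (ltW e0))).
  rewrite leeD2r//; apply: le_trans (ltW Ue).
  by apply: subset_lee_nneseries.
rewrite -EFinD lee_fin => le2.
have := le_trans le1 (ler_wpM2l (ltW E0) (le_trans sum_le (ler_wpM2l (powR_ge0 2 t) le2))).
rewrite mulrA (mulrC E) -/lam /e leNgt => /negP; apply.
have -> : lam * ((4 * lam)^-1 + (4 * lam)^-1) = 2^-1 by field; rewrite gt_eqF.
by rewrite invf_lt1// ltr1n.
Qed.

End EnergyLowerBound.

(** * Fatou's lemma and random energies *)

Section Fatou.
Context {R : realType} {dT : measure_display} {T : measurableType dT}.
Variable P : probability T R.

Lemma limn_einf_supE (u : (\bar R)^nat) : limn_einf u = ereal_sup (range (einfs u)).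
Proof. by rewrite limn_einf_lim; apply/cvg_lim => //; exact: cvg_einfs_sup. Qed.

(** By Fatou the lower limit is integrable, hence almost everywhere finite, and any larger bound is
    met for infinitely many [N]. *)
Lemma ae_frequently_bounded (F : (T -> \bar R)^nat) (C : R) :
  (forall N, measurable_fun setT (F N)) -> (forall N w, (0 <= F N w)%E) ->
  (forall N, (\int[P]_w F N w <= C%:E)%E) ->
  {ae P, forall w, exists2 E : R, 0 < E &
    forall N0, exists2 N, (N0 <= N)%N & (F N w <= E%:E)%E}.
Proof.
move=> mF F0 FC.
have G0 w : (0 <= limn_einf (F ^~ w))%E.
  rewrite limn_einf_supE; apply: (@le_trans _ _ (einfs (F ^~ w) 0%N)).
    by apply: le_ereal_inf_tmp => _ [N _ <-].
  by apply: ereal_sup_ubound; exists 0%N.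
have mG : measurable_fun setT (fun w => limn_einf (F ^~ w)).
  rewrite (_ : (fun w => _) = (fun w => - limn_esup (fun N => - F N w))%E)//.
  apply: measurableT_comp => //; apply: measurable_fun_limn_esup => N.
  exact: measurableT_comp.
have iG : (\int[P]_w limn_einf (F ^~ w) <= C%:E)%E.
  apply: le_trans (fatou _ _ _ _) _ => //.
  rewrite limn_einf_supE; apply: ge_ereal_sup => _ [N _ <-].
  apply: le_trans (FC N); apply: ereal_inf_lbound; exists N => //.
  by rewrite /= leqnn.
have intG : P.-integrable setT (fun w => limn_einf (F ^~ w)).
  apply/integrableP; split => //.
  under eq_integral do rewrite gee0_abs//.
  exact: le_lt_trans iG (ltry _).
have := integrable_ae measurableT intG.
apply: filterS => w /(_ I) fin.
pose l := fine (limn_einf (F ^~ w)).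
have l0 : 0 <= l by apply: fine_ge0.
exists (l + 1); first by rewrite ltr_wpDl.
move=> N0; have : (einfs (F ^~ w) N0 < (l + 1)%:E)%E.
  apply: (@le_lt_trans _ _ l%:E); last by rewrite lte_fin ltrDl.
  rewrite /l fineK// limn_einf_supE; apply: ereal_sup_ubound.
  by exists N0.
move=> /ereal_inf_lt[_ [N /= N0N <-] /ltW FN].
by exists N.
Qed.

Lemma integral_indic_sum (I : finType) (c b : I -> R) (B : I -> set T) :
  (forall i, 0 <= c i) -> (forall i, measurable (B i)) ->
  (forall i, (P (B i) <= (b i)%:E)%E) ->
  measurable_fun setT (fun w => \sum_i (c i)%:E * (\1_(B i) w)%:E)%E /\
  (\int[P]_w (\sum_i (c i)%:E * (\1_(B i) w)%:E) <= (\sum_i c i * b i)%:E)%E.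
Proof.
move=> c0 mB Bb.
have mi i : measurable_fun setT (fun w => (c i)%:E * (\1_(B i) w)%:E)%E.
  apply: emeasurable_funM => //; apply/measurable_EFinP; exact: measurable_indic.
have ge0 i w : (0 <= (c i)%:E * (\1_(B i) w)%:E)%E by rewrite mule_ge0// lee_fin.
split; first exact: emeasurable_sum.
rewrite ge0_integral_sum// -sumEFin; apply: lee_sum => i _.
rewrite ge0_integralZl_EFin//; last by apply/measurable_EFinP; exact: measurable_indic.
rewrite integral_indic// setIT EFinM; apply: lee_wpmul2l; last exact: Bb.
by rewrite lee_fin.
Qed.

End Fatou.

Section KernelBound.
Context {R : realType}.

(** Since [r / M <= 1], the exponent [k] may be lowered to [s + v]. [M] dominates both truncated
    distances, the second raised to [al], as the cut-offs stay below [r]. *)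
Lemma power_kernel_le (k : nat) (s v al r z Y e1 e2 : R) :
  0 <= s -> 0 <= v -> s + v <= k%:R -> 0 < al -> 0 < r -> 0 <= z -> 0 <= Y ->
  0 < e1 -> e1 <= r -> 0 < e2 -> e2 `^ al <= r ->
  (r / Num.max (Num.max z (Y `^ al)) r) ^+ k <=
  r `^ (s + v) * (Num.max z e1 `^ (- s) * Num.max Y e2 `^ (- (al * v))).
Proof.
move=> s0 v0 svk al0 r0 z0 Y0 e10 e1r e20 e2r.
set M := Num.max _ r; have rM : r <= M by rewrite le_max lexx orbT.
have M0 : 0 < M by exact: lt_le_trans rM.
have A0 : 0 < Num.max z e1 by rewrite lt_max e10 orbT.
have D0 : 0 < Num.max Y e2 by rewrite lt_max e20 orbT.
have AM : Num.max z e1 <= M.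
  by rewrite ge_max (le_trans e1r rM) andbT /M !le_max lexx.
have DM : Num.max Y e2 `^ al <= M.
  case: (leP Y e2) => _;
    first by rewrite (le_trans e2r rM).
  by rewrite le_max; apply/orP; left; rewrite le_max lexx orbT.
have inv_le (x y p : R) : 0 < x -> x <= y -> 0 <= p -> y `^ (- p) <= x `^ (- p).
  move=> x0 xy p0; have y0 := lt_le_trans x0 xy.
  rewrite !powRN lef_pV2 ?posrE ?powR_gt0//.
  by apply: ge0_ler_powR; rewrite ?nnegrE ?(ltW x0) ?(ltW y0).
rewrite -powR_mulrn; last by rewrite divr_ge0 ?(ltW r0) ?(ltW M0).
apply: (@le_trans _ _ ((r / M) `^ (s + v))).
  by apply: ger_powR => //; rewrite divr_gt0//= ler_pdivrMr// mul1r.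
rewrite powRM ?(ltW r0) ?invr_ge0 ?(ltW M0)//; apply: ler_wpM2l; first exact: powR_ge0.
rewrite -powR_inv1 ?(ltW M0)// -powRrM mulN1r opprD powRD; last first.
  by apply/implyP => _; rewrite gt_eqF.
apply: ler_pM; rewrite ?powR_ge0//; first exact: inv_le.
by rewrite -mulrN powRrM; apply: inv_le => //; rewrite powR_gt0.
Qed.

Lemma sum_prod_factor (I J : finType) (f : I -> I -> R) (g : J -> J -> R) :
  \sum_(a : I * J) \sum_(b : I * J) f a.1 b.1 * g a.2 b.2 =
  (\sum_a \sum_b f a b) * (\sum_a \sum_b g a b).
Proof.
rewrite big_distrlr/= [RHS]pair_bigA; apply: eq_bigr => a _.
by rewrite big_distrlr/= [RHS]pair_bigA.
Qed.

End KernelBound.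

Section RandomEnergy.
Context {R : realType} {k d n : nat}.
Variable phi : {linear 'rV[R]_k -> 'rV[R]_d}.
Hypothesis phi_iso : forall u, enorm (phi u) = enorm u.
Variable alpha : R.
Hypothesis alpha0 : 0 < alpha.
Context {dT : measure_display} {T : measurableType dT}.
Variable P : probability T R.
Variable W : 'rV[R]_n -> T -> 'rV[R]_k.
Hypothesis hW : fractional_brownian_motion P alpha W.
Hypothesis k0 : (0 < k)%N.
Variables (K : set 'rV[R]_d) (L : set 'rV[R]_n) (s v t C1 C2 : R).
Hypotheses (s0 : 0 <= s) (v0 : 0 <= v) (svk : s + v <= k%:R) (tsv : t < s + v).
Hypothesis KC : finite_energy K s C1.
Hypothesis LC : finite_energy L (alpha * v) C2.

Let S w : set 'rV[R]_d := sumset K [set phi (W y w) | y in L].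

(** [F] replaces the indicators in the kernel by those of enclosing measurable events, so it
    dominates the energy. In expectation scale [j] contributes at most a constant times
    [2 ^ ((t - s - v) j)] times the energies on [K] and [L], which is summable. *)
Lemma random_energy : exists C : R, forall N, exists F : T -> \bar R,
  [/\ measurable_fun setT F, forall w, (0 <= F w)%E, (\int[P]_w F w <= C%:E)%E &
    forall w (E : R), (F w <= E%:E)%E -> bounded_energy (S w) t E N].
Proof.
have [Cb Cb0 HB] := increment_small_ball phi_iso alpha0 hW k0.
exists (Cb * (1 - 2 `^ (t - (s + v)))^-1 * (C1 * C2)) => N.
have N0 : 0 < 2 ^- N :> R by rewrite invr_gt0 exprn_gt0.
(* Its power [alpha] is [2 ^- N], the cut-off used on [K]. *)
pose e2 : R := (2 ^- N) `^ alpha^-1.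
have e20 : 0 < e2 by rewrite powR_gt0.
have [n1 [x [p [xK p0 p1 pC]]]] := KC N0.
have [n2 [y [q [yL q0 q1 qC]]]] := LC e20.
pose I := ('I_n1 * 'I_n2)%type.
pose r (j : nat) : R := 2 ^- j.
have r0 j : 0 < r j by rewrite invr_gt0 exprn_gt0.
pose idx := ((I * I) * 'I_N)%type.
pose z (a b : I) := x a.1 - x b.1.
have /choice[B HBB] : forall i : idx, exists B, [/\ measurable B,
    forall w, `|z i.1.1 i.1.2 + phi (W (y i.1.1.2) w - W (y i.1.2.2) w)| <= r i.2 -> B w &
    (P B <= (Cb * (r i.2 / Num.max (Num.max `|z i.1.1 i.1.2|
        (`|y i.1.1.2 - y i.1.2.2| `^ alpha)) (r i.2)) ^+ k)%:E)%E].
  by move=> i; exact: HB.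
pose pq (a : I) := p a.1 * q a.2.
have pq0 a : 0 <= pq a by rewrite mulr_ge0.
pose c (i : idx) := pq i.1.1 * pq i.1.2 * (2 `^ t) ^+ i.2.
have c0 i : 0 <= c i by rewrite mulr_ge0 ?mulr_ge0// exprn_ge0// powR_ge0.
have mB i : measurable (B i) by have [] := HBB i.
pose bb (i : idx) := Cb * (r i.2 / Num.max (Num.max `|z i.1.1 i.1.2|
  (`|y i.1.1.2 - y i.1.2.2| `^ alpha)) (r i.2)) ^+ k.
have PB i : (P (B i) <= (bb i)%:E)%E by have [_ _] := HBB i.
have [mF intF] := integral_indic_sum c0 mB PB.
exists (fun w => \sum_i (c i)%:E * (\1_(B i) w)%:E)%E; split => //.
- by move=> w; apply: sume_ge0 => i _; rewrite mule_ge0// lee_fin.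
- apply: (le_trans intF); rewrite lee_fin.
  pose f (a b : 'I_n1) := p a * p b * Num.max `|x a - x b| (2 ^- N) `^ (- s).
  pose g (a b : 'I_n2) := q a * q b * Num.max `|y a - y b| e2 `^ (- (alpha * v)).
  have f0 a b : 0 <= f a b by rewrite mulr_ge0 ?powR_ge0// mulr_ge0.
  have g0 a b : 0 <= g a b by rewrite mulr_ge0 ?powR_ge0// mulr_ge0.
  apply: (@le_trans _ _ (\sum_(i : idx) Cb * (2 `^ (t - (s + v))) ^+ i.2 *
      (f i.1.1.1 i.1.2.1 * g i.1.1.2 i.1.2.2))).
    apply: ler_sum => -[[a b] j] _ /=; rewrite /c /bb /=.
    have rj : 2 ^- N <= r j.
      rewrite /r lef_pV2 ?posrE ?exprn_gt0// ler_eXn2l ?ltr1n//.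
      exact: ltnW.
    have e2r : e2 `^ alpha <= r j.
      by rewrite /e2 -powRrM mulVf ?gt_eqF// powRr1// ltW.
    have := power_kernel_le s0 v0 svk alpha0 (r0 j) (normr_ge0 (z a b))
      (normr_ge0 (y a.2 - y b.2)) N0 rj e20 e2r.
    move=> le1.
    have -> : Cb * 2 `^ (t - (s + v)) ^+ j * (f a.1 b.1 * g a.2 b.2) =
      pq a * pq b * 2 `^ t ^+ j * (Cb * (r j `^ (s + v) *
       (Num.max `|z a b| (2 ^- N) `^ (- s) *
        Num.max `|y a.2 - y b.2| e2 `^ (- (alpha * v))))).
      rewrite /f /g /pq /z /r powRD ?pnatr_eq0 ?implybT// exprMn powR_geometric; ring.
    apply: ler_wpM2l; first exact: (c0 (a, b, j)).
    by apply: ler_wpM2l => //; exact: ltW.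
  rewrite -(pair_bigA _ (fun ab (j : 'I_N) => Cb * (2 `^ (t - (s + v))) ^+ j *
      (f ab.1.1 ab.2.1 * g ab.1.2 ab.2.2)))/=.
  under eq_bigr do rewrite -mulr_suml -mulr_sumr.
  rewrite -mulr_sumr -(pair_bigA _ (fun a b : I => f a.1 b.1 * g a.2 b.2))/=.
  rewrite sum_prod_factor.
  apply: ler_pM.
  - by rewrite mulr_ge0 ?(ltW Cb0)// sumr_ge0// => j _; rewrite exprn_ge0// powR_ge0.
  - by rewrite mulr_ge0// sumr_ge0// => a _; rewrite sumr_ge0.
  - apply: ler_wpM2l; first exact: ltW.
    apply: geometric_sum_le; rewrite powR_ge0/=.
    by rewrite -[ltRHS](powRr0 2) /powR pnatr_eq0/= ltr_expR ltr_pM2r ?subr_lt0// ln_gt0// ltr1n.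
  - apply: ler_pM => //; by rewrite sumr_ge0// => a _; rewrite sumr_ge0.
- move=> w E FE; pose u (a : I) := x a.1 + phi (W (y a.2) w).
  exists I, u, pq; split => //.
  + move=> a; exists (x a.1); first exact: xK.
    by exists (phi (W (y a.2) w)) => //; exists (y a.2) => //; exact: yL.
  + by rewrite -(pair_bigA _ (fun (a : 'I_n1) (b : 'I_n2) => p a * q b))/= -big_distrlr/= p1 q1 mulr1.
  rewrite -lee_fin; apply: le_trans FE.
  rewrite (_ : (\sum_i (c i)%:E * (\1_(B i) w)%:E)%E = (\sum_i c i * \1_(B i) w)%:E); last first.
    by rewrite -sumEFin; apply: eq_bigr => i _; rewrite EFinM.
  rewrite lee_fin pair_bigA/=.
  under eq_bigr do rewrite /dyadic_kernel mulr_sumr.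
  rewrite pair_bigA/=; apply: ler_sum => -[[a b] j] _ /=.
  case: ifPn => [near|_]; last by rewrite mulr0 mulr_ge0.
  rewrite /c /= indicE mem_set ?mulr1//.
  have [_ H _] := HBB (a, b, j); apply: H => /=.
  rewrite (_ : z a b + phi (W (y a.2) w - W (y b.2) w) = u a - u b)//.
  by rewrite /u /z linearB/= opprD addrACA.
Qed.

Lemma ae_bounded_energy : {ae P, forall w, exists2 E : R, 0 < E &
    forall N0, exists2 N, (N0 <= N)%N & bounded_energy (S w) t E N}.
Proof.
have [C /choice[F HF]] := random_energy.
have mF N : measurable_fun setT (F N) by have [] := HF N.
have F0 N w : (0 <= F N w)%E by have [_ + _ _] := HF N.
have FC N : (\int[P]_w F N w <= C%:E)%E by have [] := HF N.
apply: filterS (ae_frequently_bounded mF F0 FC) => w [E E0 HE]; exists E => // N0.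
have [N N0N FN] := HE N0; exists N => //.
by have [_ _ _] := HF N; exact.
Qed.

End RandomEnergy.

(** * Choice of exponents and conclusion *)

Section Exponents.
Context {R : realType}.

(** Here [a] and [b] stand for the dimensions of [X] and [Y]. If [t < a], then [v = 0] will do;
    otherwise [s] is slightly below [a], or 0, and [v] supplies the rest. *)
Lemma split_exponent (al t k : R) (a b : \bar R) : 0 < al -> 0 <= t -> t < k ->
  (0 <= a)%E -> a \is a fin_num -> (t%:E < a + b * (al^-1)%:E)%E ->
  exists s v, [/\ 0 <= s, 0 <= v, t < s + v <= k,
    s = 0 \/ (s%:E < a)%E & al * v = 0 \/ ((al * v)%:E < b)%E].
Proof.
move=> al0 t0 tk; case: a => [x| |] //; rewrite lee_fin => x0 _ tab.
have [tx|xt] := ltP t x.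
  exists ((t + Num.min x k) / 2), 0.
  have h : t < Num.min x k by rewrite lt_min tx.
  have h1 : Num.min x k <= x by rewrite ge_min lexx.
  have h2 : Num.min x k <= k by rewrite ge_min lexx orbT.
  rewrite mulr0; split; [lra|lra|apply/andP; split; lra|right; rewrite lte_fin; lra|by left].
have : ((al * (t - x))%:E < b)%E.
  move: tab; case: b => [b| |] tab; first 1 last.
  - exact: ltry.
  - by move: tab; rewrite gt0_mulNye ?lte_fin ?invr_gt0.
  move: tab; rewrite -EFinM -EFinD !lte_fin => h.
  by rewrite mulrC -ltr_pdivlMr//; lra.
move=> /lt_ereal_between[c tc cb].
(* The slack: [s] loses [e] and [v] gains [2 * e], so that [s + v] exceeds [t] by [e]; if [x < e],
   then [s] is 0 instead. *)
pose e := Num.min ((c / al - (t - x)) / 2) ((k - t) / 2).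
have e0 : 0 < e.
  rewrite lt_min !divr_gt0 ?subr_gt0// ltr_pdivlMr// mulrC.
  exact: tc.
have e1 : 2 * e <= c / al - (t - x).
  have : e <= (c / al - (t - x)) / 2 by rewrite ge_min lexx.
  lra.
have e2 : 2 * e <= k - t.
  have : e <= (k - t) / 2 by rewrite ge_min lexx orbT.
  lra.
have alv : ((al * (t - x + 2 * e))%:E < b)%E.
  apply: le_lt_trans cb; rewrite lee_fin mulrC -ler_pdivlMr//; lra.
have [ex|xe] := leP e x.
  exists (x - e), (t - x + 2 * e).
  by split; [lra|lra|apply/andP; split; lra|right; rewrite lte_fin; lra|right].
by exists 0, (t - x + 2 * e); split; [|lra|apply/andP; split; lra|left|right].
Qed.

End Exponents.

Section Main.
Context {R : realType} {k d n : nat}.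
Variable phi : {linear 'rV[R]_k -> 'rV[R]_d}.
Hypothesis phi_iso : forall u, enorm (phi u) = enorm u.
Variable alpha : R.
Hypothesis alpha0 : 0 < alpha.
Context {dT : measure_display} {T : measurableType dT}.
Variable P : probability T R.
Variable W : 'rV[R]_n -> T -> 'rV[R]_k.
Hypothesis hW : fractional_brownian_motion P alpha W.
Hypothesis k0 : (0 < k)%N.

Lemma isometry_continuous : continuous phi.
Proof.
move=> u B /nbhs_ballP[e /= e0 eB]; apply/nbhs_ballP.
exists (e / k.+1%:R) => /=; first exact: divr_gt0.
move=> y; rewrite -ball_normE /= ltr_pdivlMr// mulrC => uy.
apply: eB; rewrite -ball_normE /=.
rewrite -linearB/= (le_lt_trans (norm_le_enorm _))// phi_iso.
rewrite (le_lt_trans (enorm_le_norm _))//; apply: le_lt_trans uy.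
by rewrite ler_wpM2r// ler_nat.
Qed.

Lemma sumset_image_compact (K : set 'rV[R]_d) (L : set 'rV[R]_n) w :
  compact K -> compact L -> compact (sumset K [set phi (W y w) | y in L]).
Proof.
move=> cK cL; have [_ cW _ _ _] := hW.
have -> : sumset K [set phi (W y w) | y in L] =
    (fun xy : 'rV[R]_d * 'rV[R]_n => xy.1 + phi (W xy.2 w)) @` (K `*` L).
  apply/seteqP; split => z.
    by move=> [x Kx [_ [y Ly <-] <-]]; exists (x, y).
  by move=> [[x y] [/= Kx Ly] <-]; exists x => //; exists (phi (W y w)) => //; exists y.
apply: continuous_compact; last exact: compact_setX.
apply: continuous_subspaceT => -[x y] /=.
apply: cvgD; first exact: cvg_fst.
apply: (cvg_comp snd (fun y => phi (W y w))); first exact: cvg_snd.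
apply: (cvg_comp (fun y => W y w) phi); first exact: cW.
exact: isometry_continuous.
Qed.

Variables (X : set 'rV[R]_d) (Y : set 'rV[R]_n).
Hypotheses (bX : borel X) (X0 : X !=set0) (bY : borel Y) (Y0 : Y !=set0).

Let A w : set 'rV[R]_d := sumset X [set phi (W y w) | y in Y].

Lemma hausdorff_dim_ge0 m (B : set 'rV[R]_m) : (0 <= hausdorff_dim B)%E.
Proof. by apply: le_ereal_inf_tmp => _ [s [s0 _] <-]; rewrite lee_fin. Qed.

(** The compact sets found in [X] and [Y] for the split exponents have a compact image sumset, of
    nonzero Hausdorff measure in every dimension below [t]. *)
Lemma ae_le_hausdorff_dim (t : R) : t < k%:R -> hausdorff_dim X \is a fin_num ->
  (t%:E < hausdorff_dim X + hausdorff_dim Y * (alpha^-1)%:E)%E ->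
  {ae P, forall w, (t%:E <= hausdorff_dim (A w))%E}.
Proof.
move=> tk finX tXY; have [t0|t0] := ltP t 0.
  by apply: aeW => w; apply: le_trans (hausdorff_dim_ge0 _); rewrite lee_fin ltW.
have [s [v [s0 v0 /andP[tsv svk] sX vY]]] :=
  split_exponent alpha0 t0 tk (hausdorff_dim_ge0 X) finX tXY.
have [K [C1 [cK KX KC]]] := discrete_frostman bX X0 s0 sX.
have av0 : 0 <= alpha * v by rewrite mulr_ge0// ltW.
have [L [C2 [cL LY LC]]] := discrete_frostman bY Y0 av0 vY.
have := ae_bounded_energy phi_iso alpha0 hW k0 s0 v0 svk tsv KC LC.
apply: filterS => w [E E0 HE].
apply: le_ereal_inf_tmp => _ [r [/= r0 Hr] <-]; rewrite lee_fin leNgt.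
apply/negP => rt; have rt' : 0 <= r <= t by rewrite r0 ltW.
apply: (hausdorff_measure_neq0 (sumset_image_compact (w := w) cK cL) _ _ rt' E0 HE Hr).
  move=> _ [x Kx [_ [y Ly <-] <-]]; exists x; first exact: KX.
  by exists (phi (W y w)) => //; exists y => //; exact: LY.
have [N _ [I [u [p [uS _ p1 _]]]]] := HE 0%N.
have [a _|I0] := pickP (fun _ : I => true); first by exists (u a).
by move: p1; rewrite big_pred0// => /eqP; rewrite eq_sym oner_eq0.
Qed.

(** The exceptional null set depends on [t], so [t] runs through a sequence tending to the
    minimum. *)
Lemma ae_min_le_hausdorff_dim : hausdorff_dim X \is a fin_num ->
  {ae P, forall w, (Order.min (hausdorff_dim X + hausdorff_dim Y * (alpha^-1)%:E) k%:R%:E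
     <= hausdorff_dim (A w))%E}.
Proof.
move=> finX; set M := Order.min _ _.
have M0 : (0 <= M)%E.
  by rewrite le_min lee_fin ler0n andbT adde_ge0 ?mule_ge0 ?hausdorff_dim_ge0// lee_fin invr_ge0 ltW.
have finM : M \is a fin_num.
  by rewrite ge0_fin_numE// (@le_lt_trans _ _ k%:R%:E) ?ltry// ge_min lexx orbT.
have tM (i : nat) : ((fine M - i.+1%:R^-1)%:E < M)%E.
  by rewrite -[ltRHS]fineK// lte_fin ltrBlDr ltrDl.
have ae_tM i : {ae P, forall w, ((fine M - i.+1%:R^-1)%:E <= hausdorff_dim (A w))%E}.
  have := tM i; rewrite {2}/M lt_min lte_fin => /andP[h1 h2].
  exact: ae_le_hausdorff_dim.
apply: filterS (ae_foralln ae_tM) => w Hw; apply/lee_addgt0Pr => e e0.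
have [i ie] : exists i : nat, i.+1%:R^-1 < e.
  have [i _ /(_ i (leqnn _))] := near_infty_natSinv_lt (PosNum e0).
  by exists i.
rewrite -[leLHS]fineK// -leeBlDr//; apply: le_trans (Hw i).
by rewrite -EFinB lee_fin lerD2l lerN2 ltW.
Qed.

End Main.

Theorem corollary8p3 (R : realType) (k d n : nat)
  (hk : (1 <= k)%N) (hkd : (k < d)%N) (hn : (1 <= n)%N)
  (V : {vspace 'rV[R]_d}) (hV : \dim V = k)
  (phi : {linear 'rV[R]_k -> 'rV[R]_d}) (hphi : isometry_onto phi V)
  (X : set 'rV[R]_d) (Y : set 'rV[R]_n)
  (hX : borel X) (hX0 : X !=set0) (hY : borel Y) (hY0 : Y !=set0)
  (alpha : R) (halpha0 : 0 < alpha) (halpha1 : alpha < 1)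
  (dT : measure_display) (T : measurableType dT) (P : probability T R)
  (W : 'rV[R]_n -> T -> 'rV[R]_k)
  (hW : fractional_brownian_motion P alpha W)
  (hdim : (hausdorff_dim X < k%:R%:E)%E) :
  {ae P, forall w,
    (Order.min
       (hausdorff_dim X + hausdorff_dim Y * (alpha^-1)%:E
        - hausdorff_dim X * hausdorff_dim Y * ((k%:R * alpha)^-1)%:E)
       k%:R%:E
     <= hausdorff_dim (sumset X [set phi (W y w) | y in Y]))%E}.
Proof.
have finX : hausdorff_dim X \is a fin_num.
  by rewrite ge0_fin_numE ?hausdorff_dim_ge0// (lt_trans hdim)// ltry.
have := ae_min_le_hausdorff_dim hphi.1 halpha0 hW hk hX hX0 hY hY0 finX.
(* The subtracted product is nonnegative, so the claimed bound is at most the one already proved. *)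
apply: filterS => w; apply: le_trans; rewrite le_min !ge_min lexx orbT andbT.
apply/orP; left; rewrite geeDl// oppe_le0 !mule_ge0 ?hausdorff_dim_ge0//.
by rewrite lee_fin invr_ge0 mulr_ge0// ltW.
Qed.
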